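(* Assume that $(u,\mu)$ is a global conservative multipeakon solution of the Camassa-Holm equation. Let $\{\lambda_i\}_{i=1}^N$ be the eigenvalues of the associated spectral problem $-f''+\frac14f=z\,\omega(\cdot,t)f+z^2v(\cdot,t)f$ on $\mathbb{R}$, and let $\lambda^\star=\min\{|\lambda_i|:i=1,\dots,N\}$. Then $$\sup\{|u(x,t)|:x,t\in\mathbb{R}\}=\frac1{2\lambda^\star}.$$ In particular, $|u(x,t)|$ attains the supremum at some $(x,t)\in\mathbb{R}^2$ if and only if $N=1$.
   Context: Camassa-Holm equation: $u_t-u_{xxt}=2u_xu_{xx}-3uu_x+uu_{xxx}$. Spectral problem: for $\omega=\sum_{i=1}^n\omega_i\delta_{x_i}$, $v=\sum_{i=1}^nv_i\delta_{x_i}$ with $n\ge1$, $x_1<\dots<x_n$ real, $\omega_i\in\mathbb{R}$, $v_i\ge0$, $|\omega_i|+v_i>0$, a solution of $-f''+\frac14f=z\omega f+z^2vf$ ($z\in\mathbb{C}$) is a continuous $f$ with $-f''+\frac14f=0$ on $\mathbb{R}\setminus\{x_1,\dots,x_n\}$ and $f'(x_i-)=f'(x_i+)+z\omega_if(x_i)+z^2v_if(x_i)$ for every $i$. Eigenvalues are the $z$ for which there is a nontrivial bounded solution; they form a finite set of nonzero reals $\lambda_1<\dots<\lambda_N$. $\phi_+(z,\cdot)$ is the solution equal to $e^{-x/2}$ near $+\infty$; for an eigenvalue $\lambda$, $\gamma_\lambda^2:=\int_{\mathbb{R}}|\phi_+(\lambda,x)|^2d\omega(x)+2\lambda\int_{\mathbb{R}}|\phi_+(\lambda,x)|^2dv(x)$,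 with $\lambda\gamma_\lambda^2>0$. Global conservative multipeakon solution $(u,\mu)$: for each $t\in\mathbb{R}$, $u(\cdot,t)=\frac12\sum_{i=1}^{n(t)}\omega_i(t)e^{-|x-x_i(t)|}$, so that $\omega(\cdot,t):=u-u_{xx}=\sum_{i=1}^{n(t)}\omega_i(t)\delta_{x_i(t)}$; $\mu(\cdot,t)$ is a nonnegative Borel measure with absolutely continuous part $\mu_{ac}(B,t)=\int_B|u(x,t)|^2+|u_x(x,t)|^2dx$, and $v(B,t):=\mu(B,t)-\int_B|u(x,t)|^2+|u_x(x,t)|^2dx$ is $\sum_{i=1}^{n(t)}v_i(t)\delta_{x_i(t)}$ with $v_i(t)\ge0$, $|\omega_i(t)|+v_i(t)>0$. The pair $(u,\mu)$ being a global conservative multipeakon solution is characterized (Eckhardt-Kostenko; this may be taken as the definition) by: the eigenvalues of the spectral problem with coefficients $\omega(\cdot,t),v(\cdot,t)$ do not depend on $t$, and $\gamma_{\lambda_i}^2(t)=e^{-\frac{t-t_0}{2\lambda_i}}\gamma_{\lambda_i}^2(t_0)$ for all $t,t_0\in\mathbb{R}$ and all eigenvalues $\lambda_i$, where $\gamma^2_{\lambda_i}(t)$ is the quantity above for the coefficients $\omega(\cdot,t),v(\cdot,t)$. *)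

(* Defs.v *)
From HB Require Import structures.
From mathcomp Require Import all_boot all_order all_algebra.
From mathcomp Require Import complex.
From mathcomp Require Import all_classical all_reals all_analysis.

Set Implicit Arguments.
Unset Strict Implicit.
Unset Printing Implicit Defensive.

Import Order.TTheory GRing.Theory Num.Theory.
Import numFieldNormedType.Exports.

Local Open Scope classical_set_scope.
Local Open Scope complex_scope.
Local Open Scope ring_scope.

(* omega = \sum_i mass i * delta_(pos i) and v = \sum_i dip i * delta_(pos i);
   the number n of point masses is part of the data, since it may vary in
   time. *)
Record coefficients (R : realType) := Coefficients {
  npts : nat;
  pos : 'I_npts -> R;
  mass : 'I_npts -> R;
  dip : 'I_npts -> R;
  npts_gt0 : (0 < npts)%N;
  pos_lt : forall i j : 'I_npts, (i < j)%N -> pos i < pos j;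
  dip_ge0 : forall i, 0 <= dip i;
  mass_dip_gt0 : forall i, 0 < `|mass i| + dip i }.

Section SpectralProblem.
Variable R : realType.
Implicit Types (c : coefficients R) (z : R[i]) (f : R -> R[i]).

Definition re_part f : R -> R := fun y => complex.Re (f y).
Definition im_part f : R -> R := fun y => complex.Im (f y).

(* R[i] carries no normed R-module structure, so calculus on functions
   R -> R[i] is done on real and imaginary parts. *)
Definition ccontinuous f := continuous (re_part f) /\ continuous (im_part f).

(* - g'' + g / 4 = 0 on U; meant for U open, so that at points of U the
   function derive1 g is the genuine derivative of g on a neighbourhood. *)
Definition free_equation (U : set R) (g : R -> R) :=
  forall y, U y ->
    [/\ derivable g y 1, derivable (derive1 g) y 1 &
        - derive1 (derive1 g) y + 4^-1 * g y = 0].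

Definition deriv_left f y (l : R[i]) :=
  derive1 (re_part f) x @[x --> y^'-] --> complex.Re l /\
  derive1 (im_part f) x @[x --> y^'-] --> complex.Im l.

Definition deriv_right f y (l : R[i]) :=
  derive1 (re_part f) x @[x --> y^'+] --> complex.Re l /\
  derive1 (im_part f) x @[x --> y^'+] --> complex.Im l.

Definition is_solution c z f :=
  [/\ ccontinuous f,
      free_equation (~` range (@pos R c)) (re_part f),
      free_equation (~` range (@pos R c)) (im_part f) &
      forall i : 'I_(npts c), exists dl dr : R[i],
        [/\ deriv_left f (pos i) dl, deriv_right f (pos i) dr &
            dl = dr + z * (mass i)%:C * f (pos i)
                    + z ^+ 2 * (dip i)%:C * f (pos i)]].

Definition is_eigenvalue c z :=
  exists f, [/\ is_solution c z f,
                exists y, f y != 0 &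
                exists M : R, forall y, ComplexField.Normc.normc (f y) <= M].

Definition is_phi_plus c z f :=
  is_solution c z f /\
  \forall y \near +oo, f y = (expR (- y / 2))%:C.

(* The solution is unique, so the choice made by xget is immaterial. *)
Definition phi_plus c z : R -> R[i] := xget (fun=> 0) (is_phi_plus c z).

(* The quantity written gamma_lambda^2; it has the sign of lambda, hence is
   not a square in general.  The integrals against omega and v are the sums
   over their point masses. *)
Definition gamma2 c (l : R) : R :=
  \sum_(i < npts c) ComplexField.Normc.normc (phi_plus c l%:C (pos i)) ^+ 2 * mass i +
  2 * l * \sum_(i < npts c) ComplexField.Normc.normc (phi_plus c l%:C (pos i)) ^+ 2 * dip i.

End SpectralProblem.

Section Multipeakon.
Variable R : realType.
Implicit Types (u : R -> R -> R) (c : coefficients R).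

Local Notation leb := (@lebesgue_measure R).

(* At the finitely many points where a multipeakon profile w is not
   differentiable, derive1 w has an irrelevant default value. *)
Definition energy (w : R -> R) (B : set (measurableTypeR R)) : \bar R :=
  (\int[leb]_(y in B) (w y ^+ 2 + derive1 w y ^+ 2)%:E)%E.

(* nu is the absolutely continuous part in the Lebesgue decomposition of m *)
Definition is_ac_part (m nu : set (measurableTypeR R) -> \bar R) :=
  (forall B, measurable B -> leb B = 0%E -> nu B = 0%E) /\
  exists S : set (measurableTypeR R), [/\ measurable S, leb S = 0%E &
    forall B, measurable B -> m (B `\` S) = nu B].

Definition multipeakon_profile c (y : R) : R :=
  2^-1 * \sum_(i < npts c) mass i * expR (- `|y - pos i|).

(* u y t is the value at position y and time t; coef t collects the
   coefficients omega(., t) and v(., t). *)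
Definition conservative_multipeakon u
    (mu : R -> {measure set (measurableTypeR R) -> \bar R})
    (coef : R -> coefficients R) :=
  [/\ forall t y, u y t = multipeakon_profile (coef t) y,
      forall t, is_ac_part (mu t) (energy (u^~ t)),
      forall t B, measurable B ->
        (mu t B - energy (u^~ t) B =
         \sum_(i < npts (coef t)) (dip i)%:E * \d_(pos i) B)%E,
      forall t s z, is_eigenvalue (coef t) z <-> is_eigenvalue (coef s) z &
      forall t t0 l, is_eigenvalue (coef t0) l%:C ->
        gamma2 (coef t) l = expR (- ((t - t0) / (2 * l))) * gamma2 (coef t0) l].

End Multipeakon.

(* Main.v *)
Require Import Defs.
From mathcomp Require Import all_boot all_order all_algebra.
From mathcomp Require Import complex.
From mathcomp Require Import all_classical all_reals all_analysis.
From mathcomp Require Import zify ring lra.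

Set Implicit Arguments.
Unset Strict Implicit.
Unset Printing Implicit Defensive.

Import Order.TTheory GRing.Theory Num.Theory.
Import numFieldNormedType.Exports.

Local Open Scope classical_set_scope.
Local Open Scope complex_scope.
Local Open Scope ring_scope.

(** Write G(x, y) = exp(-|x - y|/2) for the Green kernel of - d^2/dx^2 + 1/4; it
is the reproducing kernel of H^1 with inner product int f'g' + fg/4, and
G(x, x) = 1.  A bounded solution of the spectral problem is
f = z G(omega f + z v f), so on H^1 (+) L^2(v) the pair (f, z f) is an
eigenvector, with eigenvalue 1/z, of

  T (f, g) = (G(omega f + v g), f),

which is self-adjoint.  For the unit vector delta_x = (G(x, .), 0) one finds
<T delta_x, delta_x> = int exp(-|x - y|) d omega(y) = 2 u(x).

- Upper bound.  With lambda_min the least |lambda_i|, the norm of T is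
1/lambda_min, so that |2 u(x)| <= 1/lambda_min ([multipeakon_bound]).

- Equality.  It forces T delta_x to be a multiple of delta_x, because delta_x is
then an extremal vector of T.  The second component gives v = 0, the first one
that omega is a point mass at x (kernels of distinct points are independent),
and such an omega has a single eigenvalue
([multipeakon_extremal_eigenvalue]).

- Sharpness.  The nonzero eigenvalues of T are simple and its null space is
orthogonal to the vectors delta_(x_i).  So at the rightmost point x = x_n the
vector delta_x is a combination of normalized eigenvectors e_i with eigenvalues
1/lambda_i.  There phi_+ equals exp(-x/2), and the squared coefficients are
p_i = exp(-x)/(lambda_i gamma_i^2).  Hence ([last_peak])

  sum_i p_i = 1   and   2 u(x_n) = sum_i p_i / lambda_i.

In time, p_i is proportional to exp(t/(2 lambda_i)).  If lambda_min = |lambda_k|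
then 1/lambda_k is the largest or the smallest of the speeds 1/lambda_i, and all
the weight goes to p_k as t tends to +oo or -oo, whence
2 u(x_n(t), t) -> 1/lambda_k ([dominant_speed]).  If N = 1, then p_1 = 1 at all
times and the supremum is attained.

The operator is realized on a finite dimensional space: its spectral measures
depend only on the Gram matrix of the vectors G(x, .), for x in a finite set,
and any vectors with that Gram matrix will do ([green_gram]).  They exist because
exp(-|x - y|/2) = exp(-x/2) exp(-y/2) min(exp x, exp y) and min is a positive
semidefinite kernel.  The scalars are complex, which gives access to the
spectral theorem for Hermitian matrices. *)

(** * General solutions of the free equation *)

Section FreeSolutions.
Variable R : realType.
Implicit Types (g h : R -> R) (A B x y : R).

Definition expo A B x := A * expR (x / 2) + B * expR (- (x / 2)).

Lemma is_derive_expo A B x :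
  is_derive x 1 (expo A B) (expo (A / 2) (- (B / 2)) x).
Proof.
rewrite /expo; apply: is_derive_eq.
rewrite /GRing.scale /=; ring.
Qed.

Lemma derive1_is_derive g x l : is_derive x 1 g l -> derive1 g x = l.
Proof. by move=> H; rewrite derive1E derive_val. Qed.

Lemma derive1_expo A B : derive1 (expo A B) = expo (A / 2) (- (B / 2)).
Proof. by apply/funext => x; exact/derive1_is_derive/is_derive_expo. Qed.

Lemma continuous_expo A B : continuous (expo A B).
Proof.
move=> x; apply: differentiable_continuous.
by apply/derivable1_diffP; case: (is_derive_expo A B x).
Qed.

Lemma derive0_cst_convex (U : set R) g :
  (forall x y z, U x -> U y -> x <= z <= y -> U z) ->
  (forall x, U x -> is_derive x 1 g 0) ->
  forall x y, U x -> U y -> g x = g y.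
Proof.
move=> Uc g0 x y Ux Uy.
wlog xy : x y Ux Uy / x <= y.
  by move=> W; have [|/ltW] := leP x y; [exact: W|move=> ?; exact/esym/W].
have Uz z : z \in `[x, y] -> U z by rewrite in_itv /=; exact: Uc.
have [z||c cxy] := @MVT_segment R g (fun=> 0) x y xy.
- by move=> zxy; apply/g0/Uz; apply: subset_itv_oo_cc zxy.
- apply: derivable_within_continuous => z /Uz /g0; by case.
- by rewrite mul0r => /eqP; rewrite subr_eq0 => /eqP.
Qed.

(** The integrating factors exp(-x/2) and exp(x/2) make (g' + g/2) exp(-x/2)
and (g' - g/2) exp(x/2) constant on the convex set U, and g is a
combination of these two constants. *)
Lemma free_equation_expo (U : set R) g :
  (forall x y z, U x -> U y -> x <= z <= y -> U z) ->
  free_equation U g -> exists A B, forall x, U x -> g x = expo A B x.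
Proof.
move=> Uc gU.
have [[m Um]|U0] := pselect (exists m, U m); last first.
  by exists 0, 0 => x Ux; case: U0; exists x.
pose P x := (derive1 g x + g x / 2) * expR (- (x / 2)).
pose Q x := (derive1 g x - g x / 2) * expR (x / 2).
have dg x : U x -> is_derive x 1 g (derive1 g x).
  by move=> /gU [dg _ _]; rewrite derive1E; exact: derivableP.
have ddg x : U x -> is_derive x 1 (derive1 g) (g x / 4).
  move=> /gU [_ d2 E]; have -> : g x / 4 = derive1 (derive1 g) x by lra.
  by rewrite [in X in is_derive _ _ _ X]derive1E; exact: derivableP.
have dP x : U x -> is_derive x 1 P 0.
  move=> Ux; have ? := dg _ Ux; have ? := ddg _ Ux.
  by rewrite /P; apply: is_derive_eq; rewrite /GRing.scale /=; field.
have dQ x : U x -> is_derive x 1 Q 0.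
  move=> Ux; have ? := dg _ Ux; have ? := ddg _ Ux.
  by rewrite /Q; apply: is_derive_eq; rewrite /GRing.scale /=; field.
exists (P m), (- Q m) => x Ux.
rewrite (derive0_cst_convex Uc dP Um Ux) (derive0_cst_convex Uc dQ Um Ux).
by rewrite /expo /P /Q expRN; field; exact: lt0r_neq0 (expR_gt0 _).
Qed.

(** The free equation is local, hence holds wherever g coincides with an
explicit solution on a neighbourhood. *)
Lemma near_expo_free g A B y : (\forall x \near y, g x = expo A B x) ->
  [/\ derivable g y 1, derivable (derive1 g) y 1,
     - derive1 (derive1 g) y + 4^-1 * g y = 0 &
     derive1 g y = expo (A / 2) (- (B / 2)) y].
Proof.
move=> gE.
have gE' : \forall x \near y, expo A B x = g x.
  by apply: filterS gE => x ->.
have dE : \forall x \near y, expo (A / 2) (- (B / 2)) x = derive1 g x.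
  have := near_join gE; apply: filterS => x xE.
  by rewrite -derive1_expo !derive1E; apply/esym/near_eq_derive.
split.
- apply: near_eq_derivable gE' _; by case: (is_derive_expo A B y).
- apply: near_eq_derivable dE _.
  by case: (is_derive_expo (A / 2) (- (B / 2)) y).
- have -> : derive1 (derive1 g) y = expo (A / 2 / 2) (- (- (B / 2) / 2)) y.
    rewrite -derive1_expo !derive1E; apply/esym/near_eq_derive.
    by apply: filterS dE.
  by rewrite (nbhs_singleton gE) /expo; field.
- by rewrite (nbhs_singleton dE).
Qed.

(** The free equation is a local condition, so it holds on the whole line,
although the coefficients may a priori change from one point to the next. *)
Lemma near_expo_global g :
  (forall y, exists A B, \forall x \near y, g x = expo A B x) ->
  exists A B, forall x, g x = expo A B x.
Proof.
move=> gE; have [||A [B AB]] := @free_equation_expo setT g; first by [].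
  by move=> y _; have [A [B /near_expo_free[]]] := gE y.
by exists A, B => x; exact: AB.
Qed.

End FreeSolutions.

(** * Sums of the Green kernel and solutions with prescribed jumps *)

Section GreenSums.
Variable R : realType.
Implicit Types (g h : R -> R) (x y : R).

Definition green x y := expR (- (`|x - y| / 2)).

Lemma greenC x y : green x y = green y x.
Proof. by rewrite /green distrC. Qed.

Lemma green_refl x : green x x = 1.
Proof. by rewrite /green subrr normr0 mul0r oppr0 expR0. Qed.

Lemma green_gt0 x y : 0 < green x y.
Proof. exact: expR_gt0. Qed.

Lemma green_le1 x y : green x y <= 1.
Proof. by rewrite /green -expR0 ler_expR oppr_le0 divr_ge0. Qed.

Lemma green_left x y : x <= y -> green x y = expo (expR (- (y / 2))) 0 x.
Proof.
move=> xy; rewrite /green /expo mul0r addr0 -expRD ler0_norm ?subr_le0//.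
by congr expR; field.
Qed.

Lemma green_right x y : y <= x -> green x y = expo 0 (expR (y / 2)) x.
Proof.
move=> xy; rewrite /green /expo mul0r add0r -expRD ger0_norm ?subr_ge0//.
by congr expR; field.
Qed.

Lemma continuous_green y : continuous (green^~ y).
Proof.
move=> x; apply: continuous_comp; last exact: continuous_expR.
apply: cvgN; apply: cvgMl; apply: (@cvg_norm _ R^o); apply: cvgB => //.
exact: cvg_cst.
Qed.

Variables (n : nat) (p : 'I_n -> R).
Implicit Types a : 'I_n -> R.

Definition green_sum a x := \sum_i a i * green x (p i).

Lemma continuous_green_sum a : continuous (green_sum a).
Proof.
apply: continuous_big => [|i _ x]; first exact: add_continuous.
by apply: cvgMr; exact: continuous_green.
Qed.

Lemma expo_sum (A B : 'I_n -> R) x :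
  \sum_i expo (A i) (B i) x = expo (\sum_i A i) (\sum_i B i) x.
Proof. by rewrite /expo !mulr_suml -big_split. Qed.

(** On an interval [x, y) free of points, the terms of a Green sum are
increasing or decreasing exponentials according to the side of their
point. The value at y itself is covered, so that this also describes the
left germ at y. *)
Lemma green_sum_left a y x : x <= y -> (forall i, p i < y -> p i < x) ->
  green_sum a x =
  expo (\sum_(i | y <= p i) a i * expR (- (p i / 2)))
       (\sum_(i | p i < y) a i * expR (p i / 2)) x.
Proof.
move=> xy H; rewrite big_mkcond [X in expo _ X]big_mkcond -expo_sum.
apply: eq_bigr => i _; have [yp|py] := leP y (p i).
  by rewrite green_left ?(le_trans xy)// /expo; ring.
by rewrite green_right ?(ltW (H _ _))// /expo; ring.
Qed.

Lemma green_sum_right a y x : y <= x -> (forall i, y < p i -> x < p i) ->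
  green_sum a x =
  expo (\sum_(i | y < p i) a i * expR (- (p i / 2)))
       (\sum_(i | p i <= y) a i * expR (p i / 2)) x.
Proof.
move=> xy H; rewrite big_mkcond [X in expo _ X]big_mkcond -expo_sum.
apply: eq_bigr => i _; have [yp|py] := leP (p i) y.
  by rewrite green_right ?(le_trans yp)// /expo; ring.
by rewrite green_left ?(ltW (H _ _))// /expo; ring.
Qed.

(** The left and right derivatives at y, computed from the two germs, differ
only through the points equal to y, each kernel having a unit jump there. *)
Lemma green_sum_jump a y :
  expo ((\sum_(i | y <= p i) a i * expR (- (p i / 2))) / 2)
       (- ((\sum_(i | p i < y) a i * expR (p i / 2)) / 2)) y -
  expo ((\sum_(i | y < p i) a i * expR (- (p i / 2))) / 2)
       (- ((\sum_(i | p i <= y) a i * expR (p i / 2)) / 2)) y =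
  \sum_(i | p i == y) a i.
Proof.
rewrite !mulr_suml -!sumrN big_mkcond [X in expo _ X]big_mkcond.
rewrite [X in _ - expo X _ _]big_mkcond [X in _ - expo _ X _]big_mkcond.
rewrite [RHS]big_mkcond -!expo_sum -sumrB.
apply: eq_bigr => i _; have [yp|py|->] := ltgtP y (p i); rewrite /expo /=.
- by rewrite !mul0r; ring.
- by rewrite !mul0r; ring.
- rewrite expRN; field; exact: lt0r_neq0 (expR_gt0 _).
Qed.

Lemma near_separated y :
  \forall x \near y, forall i, (p i < y -> p i < x) /\ (y < p i -> x < p i).
Proof.
suff H i : \forall x \near y, (p i < y -> p i < x) /\ (y < p i -> x < p i).
  exact: filter_forall H.
have [yp|py|<-] := ltgtP (p i) y.
- near=> x; split=> // _; near: x; exact: lt_nbhsr.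
- near=> x; split=> // _; near: x; exact: lt_nbhsl.
- by near=> x; split.
Unshelve. all: by end_near. Qed.

(** The punctured neighbourhoods are turned into intervals, on which the free
equation can be solved. *)
Lemma at_leftP y (P : set R) :
  (\forall x \near y^'-, P x) <->
  exists2 e, 0 < e & forall x, y - e < x < y -> P x.
Proof.
split=> [[e/= e0 H]|[e e0 H]].
  by exists e => // x /andP[? ?]; apply: H => //=; rewrite ger0_norm; lra.
exists e => //= x /=; rewrite ltr_distlC => /andP[? ?] ?; apply: H; lra.
Qed.

Lemma at_rightP y (P : set R) :
  (\forall x \near y^'+, P x) <->
  exists2 e, 0 < e & forall x, y < x < y + e -> P x.
Proof.
split=> [[e/= e0 H]|[e e0 H]].
  by exists e => // x /andP[? ?]; apply: H => //=; rewrite ler0_norm; lra.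
exists e => //= x /=; rewrite ltr_distlC => /andP[? ?] ?; apply: H; lra.
Qed.

Lemma derive1_left_cvg g y A B : (\forall x \near y^'-, g x = expo A B x) ->
  derive1 g x @[x --> y^'-] --> expo (A / 2) (- (B / 2)) y.
Proof.
move=> /at_leftP[e e0 H].
have E : \forall x \near y^'-, expo (A / 2) (- (B / 2)) x = derive1 g x.
  apply/at_leftP; exists e => // x xe.
  have /near_expo_free[_ _ _ ->]// : \forall x' \near x, g x' = expo A B x'.
  have : \forall x' \near x, x' \in `]y - e, y[%R by exact: near_in_itvoo.
  by apply: filterS => x' /=; rewrite in_itv => /H.
apply: cvg_trans (near_eq_cvg E) _; apply: cvg_at_left_filter.
exact: continuous_expo.
Qed.

Lemma derive1_right_cvg g y A B : (\forall x \near y^'+, g x = expo A B x) ->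
  derive1 g x @[x --> y^'+] --> expo (A / 2) (- (B / 2)) y.
Proof.
move=> /at_rightP[e e0 H].
have E : \forall x \near y^'+, expo (A / 2) (- (B / 2)) x = derive1 g x.
  apply/at_rightP; exists e => // x xe.
  have /near_expo_free[_ _ _ ->]// : \forall x' \near x, g x' = expo A B x'.
  have : \forall x' \near x, x' \in `]y, y + e[%R by exact: near_in_itvoo.
  by apply: filterS => x' /=; rewrite in_itv => /H.
apply: cvg_trans (near_eq_cvg E) _; apply: cvg_at_right_filter.
exact: continuous_expo.
Qed.

Lemma green_sum_near_left a y : \forall x \near y^'-, green_sum a x =
  expo (\sum_(i | y <= p i) a i * expR (- (p i / 2)))
       (\sum_(i | p i < y) a i * expR (p i / 2)) x.
Proof.
have [e/= e0 H] := near_separated y; apply/at_leftP; exists e => // x xe.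
apply: green_sum_left => [|i]; first by lra.
by have [] : _ /\ _ := H x _ i; rewrite //= ltr_distlC; lra.
Qed.

Lemma green_sum_near_right a y : \forall x \near y^'+, green_sum a x =
  expo (\sum_(i | y < p i) a i * expR (- (p i / 2)))
       (\sum_(i | p i <= y) a i * expR (p i / 2)) x.
Proof.
have [e/= e0 H] := near_separated y; apply/at_rightP; exists e => // x xe.
apply: green_sum_right => [|i]; first by lra.
by have [] : _ /\ _ := H x _ i; rewrite //= ltr_distlC; lra.
Qed.

Lemma free_equation_green_sum a : free_equation (~` range p) (green_sum a).
Proof.
move=> y py; suff /near_expo_free[] : \forall x \near y, green_sum a x =
  expo (\sum_(i | y <= p i) a i * expR (- (p i / 2)))
       (\sum_(i | p i < y) a i * expR (p i / 2)) x by [].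
have := near_separated y; apply: filterS => x H.
have [xy|yx] := leP x y; first by apply: green_sum_left => // i; exact: (H i).1.
rewrite (@green_sum_right a y x (ltW yx)); last by move=> i; exact: (H i).2.
have neq i : (y == p i) = false by apply/eqP => E; apply: py; exists i.
congr expo; apply: eq_bigl => i; first by rewrite le_eqVlt neq.
by rewrite le_eqVlt eq_sym neq.
Qed.

Lemma glue_expo A B A' B' y : expo A B y = expo A' B' y ->
  expo (A / 2) (- (B / 2)) y = expo (A' / 2) (- (B' / 2)) y ->
  A = A' /\ B = B'.
Proof.
rewrite /expo expRN => H1 H2; have e0 := expR_gt0 (y / 2).
set e := expR _ in H1 H2 e0 *.
have ie : e^-1 != 0 by rewrite invr_eq0 lt0r_neq0.
split.
  by apply: (mulIf (lt0r_neq0 e0)); lra.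
by apply: (mulIf ie); lra.
Qed.

Lemma punctured_expo g y : free_equation (~` range p) g ->
  (exists A B, \forall x \near y^'-, g x = expo A B x) /\
  (exists A B, \forall x \near y^'+, g x = expo A B x).
Proof.
move=> gE; have [e/= e0 H] := near_separated y; split.
  have [||A [B AB]] := @free_equation_expo R [set x | y - e < x < y] g.
  - by move=> x x' z /=; lra.
  - move=> x/= xe; apply: gE => -[i _ pix].
    have [] : _ /\ _ := H x _ i; first by rewrite //= ltr_distlC; lra.
    by rewrite pix; lra.
  by exists A, B; apply/at_leftP; exists e.
have [||A [B AB]] := @free_equation_expo R [set x | y < x < y + e] g.
- by move=> x x' z /=; lra.
- move=> x/= xe; apply: gE => -[i _ pix].
  have [] : _ /\ _ := H x _ i; first by rewrite //= ltr_distlC; lra.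
  by rewrite pix; lra.
by exists A, B; apply/at_rightP; exists e.
Qed.

(** Subtracting the Green sum with coefficients a cancels the jumps of the
derivative. The left and right germs of the difference then have the same
value and derivative at each point, hence are the same solution of the
free equation. *)
Lemma green_representation g a : injective p ->
  continuous g -> free_equation (~` range p) g ->
  (forall i, exists dl dr,
    [/\ derive1 g x @[x --> (p i)^'-] --> dl,
        derive1 g x @[x --> (p i)^'+] --> dr & dl = dr + a i]) ->
  exists A B, forall x, g x = expo A B x + green_sum a x.
Proof.
move=> pinj gc gE gj.
suff [A [B AB]] : exists A B, forall x, g x - green_sum a x = expo A B x.
  by exists A, B => x; rewrite -AB subrK.
apply: near_expo_global => y.
have [[A [B gl]] [A' [B' gr]]] := punctured_expo y gE.
have gyl : g y = expo A B y.
  apply: (norm_cvg_unique (cvg_at_left_filter (gc y))).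
  have E : \forall x \near y^'-, expo A B x = g x by apply: filterS gl => x ->.
  apply: cvg_trans (near_eq_cvg E) _; apply: cvg_at_left_filter.
  exact: continuous_expo.
have gyr : g y = expo A' B' y.
  apply: (norm_cvg_unique (cvg_at_right_filter (gc y))).
  have E : \forall x \near y^'+, expo A' B' x = g x.
    by apply: filterS gr => x ->.
  apply: cvg_trans (near_eq_cvg E) _; apply: cvg_at_right_filter.
  exact: continuous_expo.
have gdl := derive1_left_cvg gl; have gdr := derive1_right_cvg gr.
(* Outside the points, the derivative is continuous and the sum is empty. *)
have jump : expo (A / 2) (- (B / 2)) y - expo (A' / 2) (- (B' / 2)) y =
    \sum_(i | p i == y) a i.
  have [[i _ pi]|py] := pselect (range p y).
    have [dl [dr []]] := gj i; rewrite pi => Hl Hr E.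
    rewrite (big_pred1 i); last by move=> j; rewrite /= -pi (inj_eq pinj).
    rewrite -(norm_cvg_unique Hl gdl)//. rewrite -(norm_cvg_unique Hr gdr)//.
    by rewrite E; ring.
  rewrite big_pred0; last by move=> i; apply/eqP => pi; apply: py; exists i.
  have [_ dd _] := gE y py.
  have dc : derive1 g x @[x --> y] --> derive1 g y.
    by apply: differentiable_continuous; exact/derivable1_diffP.
  rewrite -(norm_cvg_unique (cvg_at_left_filter dc) gdl)//.
  by rewrite -(norm_cvg_unique (cvg_at_right_filter dc) gdr)// subrr.
have J := green_sum_jump a y; rewrite -jump in J.
have Sl := @green_sum_left a y y (lexx _) (fun _ => id).
have Sr := @green_sum_right a y y (lexx _) (fun _ => id).
have Snl := green_sum_near_left a y; have Snr := green_sum_near_right a y.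
move: J Sl Sr Snl Snr.
set X := \sum_(i | y <= p i) _; set Y := \sum_(i | p i < y) _.
set X' := \sum_(i | y < p i) _; set Y' := \sum_(i | p i <= y) _.
move=> J Sl Sr Snl Snr.
have [eA eB] : A - X = A' - X' /\ B - Y = B' - Y'.
  by apply: (@glue_expo _ _ _ _ y);
    move: gyl gyr Sl Sr J; rewrite /expo; lra.
exists (A - X), (B - Y).
have [e1 e10 H1] : exists2 e, 0 < e & forall x, y - e < x < y ->
    g x - green_sum a x = expo (A - X) (B - Y) x.
  by apply/at_leftP; apply: filterS2 gl Snl => x -> ->; rewrite /expo; ring.
have [e2 e20 H2] : exists2 e, 0 < e & forall x, y < x < y + e ->
    g x - green_sum a x = expo (A - X) (B - Y) x.
  apply/at_rightP; apply: filterS2 gr Snr => x -> ->; rewrite eA eB /expo; ring.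
exists (Num.min e1 e2); first by rewrite /= lt_min e10 e20.
move=> x /=; rewrite ltr_distlC => xe.
have m1 : Num.min e1 e2 <= e1 by rewrite ge_min lexx.
have m2 : Num.min e1 e2 <= e2 by rewrite ge_min lexx orbT.
have [xy|xy|->] := ltgtP x y; first by apply: H1; lra.
  by apply: H2; lra.
by rewrite gyl Sl /expo; ring.
Qed.

End GreenSums.

(** * The spectral problem as a finite linear system *)

Section ComplexSolutions.
Variables (R : realType) (c : coefficients R).
Local Notation n := (npts c).
Local Notation x_ := (@pos R c).
Local Notation normc := ComplexField.Normc.normc.
Implicit Types (z A B : R[i]) (f : R -> R[i]) (F : 'I_n -> R[i]).

Lemma pos_inj : injective x_.
Proof.
move=> i j E; have [/pos_lt|/pos_lt|/val_inj//] := ltngtP i j.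
  by rewrite E ltxx.
by rewrite E ltxx.
Qed.

Lemma pos_ltn i j : x_ i < x_ j -> (i < j)%N.
Proof.
rewrite ltNge; apply: contraNltn; rewrite leq_eqVlt.
move=> /predU1P[E|/pos_lt/ltW//].
by rewrite (val_inj E).
Qed.

Definition last_point : 'I_n := Ordinal (eq_ind_r (fun m => (n.-1 < m)%N)
  (leqnn _) (esym (prednK (npts_gt0 c)))).

Lemma pos_le_last i : x_ i <= x_ last_point.
Proof.
have : (i <= last_point)%N by rewrite /= -ltnS prednK ?npts_gt0.
rewrite leq_eqVlt => /predU1P[E|/pos_lt/ltW//].
by rewrite (_ : i = last_point)//; exact/val_inj.
Qed.

Lemma Re_sum (I : finType) (G : I -> R[i]) :
  complex.Re (\sum_i G i) = \sum_i complex.Re (G i).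
Proof. exact: (raddf_sum (@complex.Re R : Rcomplex R -> R)). Qed.

Lemma Im_sum (I : finType) (G : I -> R[i]) :
  complex.Im (\sum_i G i) = \sum_i complex.Im (G i).
Proof. exact: (raddf_sum (@complex.Im R : Rcomplex R -> R)). Qed.

Lemma ReD (w w' : R[i]) : complex.Re (w + w') = complex.Re w + complex.Re w'.
Proof. by case: w w' => a b []. Qed.

Lemma ImD (w w' : R[i]) : complex.Im (w + w') = complex.Im w + complex.Im w'.
Proof. by case: w w' => a b []. Qed.

Lemma ReMr (w : R[i]) (r : R) : complex.Re (w * r%:C) = complex.Re w * r.
Proof. by case: w => a b; simpc. Qed.

Lemma ImMr (w : R[i]) (r : R) : complex.Im (w * r%:C) = complex.Im w * r.
Proof. by case: w => a b; simpc. Qed.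

(** The jump f'(x_i-) - f'(x_i+) of the derivative of a solution f is
weight z i * f (x_i). *)
Definition weight z (i : 'I_n) : R[i] := z * (mass i)%:C + z ^+ 2 * (dip i)%:C.

(** The function that the values F at the points would determine if F came
from a bounded solution. *)
Definition green_ext z (F : 'I_n -> R[i]) (x : R) : R[i] :=
  \sum_i weight z i * F i * (green x (x_ i))%:C.

Lemma re_green_ext z F : re_part (green_ext z F) =
  green_sum x_ (fun i => complex.Re (weight z i * F i)).
Proof.
apply/funext => x; rewrite /re_part /green_ext Re_sum.
by apply: eq_bigr => i _; rewrite ReMr.
Qed.

Lemma im_green_ext z F : im_part (green_ext z F) =
  green_sum x_ (fun i => complex.Im (weight z i * F i)).
Proof.
apply/funext => x; rewrite /im_part /green_ext Im_sum.
by apply: eq_bigr => i _; rewrite ImMr.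
Qed.

Lemma complex_eq (w w' : R[i]) :
  complex.Re w = complex.Re w' -> complex.Im w = complex.Im w' -> w = w'.
Proof. by case: w w' => a b [a' b'] /= -> ->. Qed.

Lemma solution_representation z f : is_solution c z f ->
  exists A B, forall x, f x = A * (expR (x / 2))%:C +
    B * (expR (- (x / 2)))%:C + green_ext z (f \o x_) x.
Proof.
move=> [[cr ci] er ei J].
have [|A [B AB]] := green_representation
    (a := fun i => complex.Re (weight z i * f (x_ i))) pos_inj cr er.
  move=> i; have [dl [dr [[lr _] [rr _] E]]] := J i.
  exists (complex.Re dl), (complex.Re dr); split => //.
  by rewrite E -addrA -mulrDl ReD.
have [|A' [B' AB']] := green_representation
    (a := fun i => complex.Im (weight z i * f (x_ i))) pos_inj ci ei.
  move=> i; have [dl [dr [[_ lr] [_ rr] E]]] := J i.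
  exists (complex.Im dl), (complex.Im dr); split => //.
  by rewrite E -addrA -mulrDl ImD.
exists (A +i* A'), (B +i* B') => x.
have E1 := AB x; have E2 := AB' x; apply: complex_eq.
  rewrite !ReD !ReMr -[complex.Re (f x)]/(re_part f x) E1.
  by congr (_ + _); rewrite -[RHS]/(re_part _ x) re_green_ext.
rewrite !ImD !ImMr -[complex.Im (f x)]/(im_part f x) E2.
by congr (_ + _); rewrite -[RHS]/(im_part _ x) im_green_ext.
Qed.

Lemma green_ext_solution z F : (forall i, F i = green_ext z F (x_ i)) ->
  is_solution c z (green_ext z F).
Proof.
move=> FE; split.
- by split; rewrite ?re_green_ext ?im_green_ext; exact: continuous_green_sum.
- by rewrite re_green_ext; exact: free_equation_green_sum.
- by rewrite im_green_ext; exact: free_equation_green_sum.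
- move=> i.
  pose D (a : 'I_n -> R) := (expo
    ((\sum_(j | x_ i <= x_ j) a j * expR (- (x_ j / 2))) / 2)
       (- ((\sum_(j | x_ j < x_ i) a j * expR (x_ j / 2)) / 2)) (x_ i)).
  pose E (a : 'I_n -> R) := (expo
    ((\sum_(j | x_ i < x_ j) a j * expR (- (x_ j / 2))) / 2)
       (- ((\sum_(j | x_ j <= x_ i) a j * expR (x_ j / 2)) / 2)) (x_ i)).
  have DE a : D a = E a + a i.
    apply/eqP; rewrite addrC -subr_eq; apply/eqP.
    rewrite /D /E green_sum_jump (big_pred1 i)// => j.
    by rewrite /= (inj_eq pos_inj).
  pose ar j := complex.Re (weight z j * F j).
  pose ai j := complex.Im (weight z j * F j).
  exists (D ar +i* D ai), (E ar +i* E ai); split.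
  + split; rewrite ?re_green_ext ?im_green_ext;
      exact/derive1_left_cvg/green_sum_near_left.
  + split; rewrite ?re_green_ext ?im_green_ext;
      exact/derive1_right_cvg/green_sum_near_right.
  + rewrite -FE -addrA -mulrDl -/(weight z i) !DE.
    by rewrite /ar /ai; case: (weight z i * F i).
Qed.

Lemma normc_sum (I : finType) (G : I -> R[i]) :
  normc (\sum_i G i) <= \sum_i normc (G i).
Proof.
elim/big_ind2: _ => [|w r w' r' H H'|i _].
- by rewrite ComplexField.Normc.normc0.
- by apply: le_trans (le_normcD _ _) _; exact: lerD.
- by [].
Qed.

Lemma normc_ge0 (w : R[i]) : 0 <= normc w.
Proof. by case: w => a b; exact: sqrtr_ge0. Qed.

Lemma normc_real (r : R) : normc r%:C = `|r|.
Proof. by rewrite /= expr0n addr0 sqrtr_sqr. Qed.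

Lemma green_ext_bounded z F x :
  normc (green_ext z F x) <= \sum_i normc (weight z i * F i).
Proof.
apply: le_trans (normc_sum _) _; apply: ler_sum => i _.
rewrite ComplexField.Normc.normcM normc_real gtr0_norm ?green_gt0//.
by rewrite ler_piMr ?green_le1// normc_ge0.
Qed.

(** At the abscissa 2t with t = (M + |B|)/|A|, the bound would give exp t <=
t. *)
Lemma growing_eq0_of_bounded A B (M : R) :
  (forall x, normc (A * (expR (x / 2))%:C + B * (expR (- (x / 2)))%:C) <= M) ->
  A = 0.
Proof.
move=> H; apply: ComplexField.Normc.eq0_normc; apply/eqP; apply: contraT => A0.
have nA0 : 0 < normc A by rewrite lt_neqAle eq_sym A0 normc_ge0.
have M0 : 0 <= M by apply: le_trans (H 0); exact: normc_ge0.
pose t := (M + normc B) / normc A.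
have t0 : 0 <= t.
  by apply: divr_ge0; [exact: addr_ge0 M0 (normc_ge0 B)|exact: ltW].
have := H (t * 2); rewrite mulfK ?pnatr_eq0 //.
set w := A * _; set w' := B * _ => H1.
have : normc w <= M + normc B.
  have -> : w = (w + w') + (- w') by rewrite addrK.
  apply: le_trans (le_normcD _ _) _; apply: lerD => //.
  rewrite normcN ComplexField.Normc.normcM normc_real ger0_norm ?expR_ge0//.
  by rewrite ler_piMr ?normc_ge0// -expR0 ler_expR oppr_le0.
rewrite ComplexField.Normc.normcM normc_real ger0_norm ?expR_ge0//.
rewrite mulrC -ler_pdivlMr// -/t => H2.
by have := expR_ge1Dx t; lra.
Qed.

Lemma expo_eq0_of_bounded A B (M : R) :
  (forall x, normc (A * (expR (x / 2))%:C + B * (expR (- (x / 2)))%:C) <= M) ->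
  A = 0 /\ B = 0.
Proof.
move=> H; split; first exact: growing_eq0_of_bounded H.
apply: (@growing_eq0_of_bounded B A M) => x.
by have := H (- x); rewrite mulNr opprK addrC.
Qed.

(** The exponential part of a solution must vanish for the solution to be
bounded, which leaves its Green sum. Conversely a Green sum is bounded and
has the jumps required of a solution as soon as it takes the values F. *)
Lemma eigenvalueP z : is_eigenvalue c z <->
  exists2 F, (exists i, F i != 0) & forall i, F i = green_ext z F (x_ i).
Proof.
split=> [[f [fs [y fy] [M fM]]]|[F [i Fi] FE]]; last first.
  exists (green_ext z F); split; first exact: green_ext_solution.
    by exists (x_ i); rewrite -FE.
  by exists (\sum_i normc (weight z i * F i)) => x; exact: green_ext_bounded.
have [A [B AB]] := solution_representation fs.
have [|A0 B0] := @expo_eq0_of_bounded A B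
  (M + \sum_i normc (weight z i * (f \o x_) i)).
  move=> x; have -> : A * (expR (x / 2))%:C + B * (expR (- (x / 2)))%:C =
      f x - green_ext z (f \o x_) x by rewrite AB; ring.
  apply: le_trans (le_normcD _ _) _; rewrite normcN; apply: lerD => //.
  exact: green_ext_bounded.
exists (f \o x_); last by move=> i; rewrite [LHS]/= AB A0 B0; ring.
apply: contrapT => H; move: fy; rewrite AB A0 B0 !mul0r !add0r.
rewrite /green_ext big1 ?eqxx// => i _.
have -> : (f \o x_) i = 0 by apply: contrapT => /eqP E; apply: H; exists i.
by rewrite mulr0 mul0r.
Qed.

(** Volterra form of the equation satisfied by a solution equal to C exp(-x/2)
near +oo: the value at x only involves those at the points on the right of
x. *)
Definition decaying z (C : R[i]) f := forall x,
  f x = C * (expR (- (x / 2)))%:C + \sum_(i | x < x_ i)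
    weight z i * f (x_ i) * (green x (x_ i) - expR (- ((x - x_ i) / 2)))%:C.

(** Right of all points the solution is A exp(x/2) + D exp(-x/2), so the
prescribed behaviour gives A = 0 and C = D. *)
Lemma solution_decaying z C f : is_solution c z f ->
  (\forall x \near +oo, f x = C * (expR (- (x / 2)))%:C) -> decaying z C f.
Proof.
move=> /solution_representation[A [B AB]] [K [_ Kf]].
pose w i := weight z i * f (x_ i).
(* The Green sum contributes to the decaying exponential only. *)
pose D := B + \sum_i w i * (expR (x_ i / 2))%:C.
have far x : x_ last_point <= x ->
    f x = A * (expR (x / 2))%:C + D * (expR (- (x / 2)))%:C.
  move=> xx; rewrite AB /D mulrDl addrA mulr_suml; congr (_ + _).
  apply: eq_bigr => i _; rewrite green_right ?(le_trans (pos_le_last i))//.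
  by rewrite /expo mul0r add0r rmorphM mulrA.
(* Comparing two abscissas beyond y eliminates the growing exponential. *)
pose y := Num.max K (x_ last_point) + 1.
have yK : K < y by rewrite /y ltr_pwDr// le_max lexx.
have yl : x_ last_point <= y by rewrite /y ler_wpDr// le_max lexx orbT.
have e (t : R) : (expR t)%:C != 0.
  by rewrite eq_complex /= eqxx andbT lt0r_neq0 ?expR_gt0.
have key x : y <= x -> A * (expR x)%:C = C - D.
  move=> yx; have := Kf x (lt_le_trans yK yx); rewrite far ?(le_trans yl)//.
  move=> E; apply: (mulIf (e (- (x / 2)))); rewrite mulrBl -E addrK.
  by rewrite -mulrA -rmorphM -expRD; congr (_ * (expR _)%:C); field.
have A0 : A = 0.
  have := key (y + 1); rewrite -(key y)// => /(_ (ler_wpDr ler01 (lexx y))).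
  move/eqP; rewrite -subr_eq0 -mulrBr mulf_eq0 => /orP[/eqP//|].
  by rewrite subr_eq0 => /eqP/complexI/expR_inj E; exfalso; lra.
have DC : C = D by have := key y (lexx _); rewrite A0 mul0r => /esym/subr0_eq.
move=> x; rewrite {1}AB A0 mul0r add0r DC /D mulrDl -addrA; congr (_ + _).
rewrite mulr_suml [X in _ = _ + X]big_mkcond -big_split; apply: eq_bigr => i _.
rewrite /= -/(w i) -mulrA -rmorphM -expRD.
have -> : x_ i / 2 + - (x / 2) = - ((x - x_ i) / 2) by field.
have [xi|xi] := ltP x (x_ i); first by rewrite -mulrDr -rmorphD addrC subrK.
rewrite addr0 green_right// /expo mul0r add0r -expRD.
by congr (_ * (expR _)%:C); field.
Qed.

(** Downward induction over the points, since the sum only involves points on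
the right of x. *)
Lemma decaying_unique z k C f f' : decaying z (k * C) f -> decaying z C f' ->
  forall x, f x = k * f' x.
Proof.
move=> fd fd'.
suff H i : f (x_ i) = k * f' (x_ i).
  move=> x; rewrite fd fd' mulrDr mulrA; congr (_ + _).
  by rewrite mulr_sumr; apply: eq_bigr => i _; rewrite H; ring.
have [m] := ubnP (n - i)%N; elim: m i => // m IH i im.
rewrite (fd (x_ i)) (fd' (x_ i)) mulrDr mulrA; congr (_ + _).
rewrite mulr_sumr; apply: eq_bigr => j /pos_ltn ij.
rewrite IH; first by ring.
by have := ltn_ord j; lia.
Qed.

Lemma decaying_last z C f : decaying z C f ->
  f (x_ last_point) = C * (expR (- (x_ last_point / 2)))%:C.
Proof.
move=> ->; rewrite big_pred0 ?addr0// => i.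
by apply: le_gtF; exact: pos_le_last.
Qed.

(** The Green sum with values F is a solution equal to C exp(-x/2) right of
all points, and C <> 0 by uniqueness. Dividing by C gives a solution
normalized like phi_plus, hence phi_plus itself; in particular the latter
exists and is not the default value. *)
Lemma eigenvector_phi_plus z F : (exists i, F i != 0) ->
  (forall i, F i = green_ext z F (x_ i)) ->
  exists C, [/\ C != 0, forall i, F i = C * phi_plus c z (x_ i) &
    F last_point = C * (expR (- (x_ last_point / 2)))%:C].
Proof.
move=> [k Fk] FE.
pose C := \sum_i weight z i * F i * (expR (x_ i / 2))%:C.
have far : \forall x \near +oo,
    green_ext z F x = C * (expR (- (x / 2)))%:C.
  exists (x_ last_point); split; first exact: num_real.
  move=> x xx; rewrite /C mulr_suml; apply: eq_bigr => i _.
  rewrite green_right ?(le_trans (pos_le_last i) (ltW xx))//.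
  by rewrite /expo mul0r add0r rmorphM mulrA.
have fs := green_ext_solution FE; have fd := solution_decaying fs far.
have C0 : C != 0.
  (* With C = 0, uniqueness compares the solution with 0 times itself. *)
  apply: contraNneq Fk => C0; rewrite C0 -[X in decaying _ X](mul0r 0) in fd.
  have fd0 : decaying z 0 (green_ext z F).
    by rewrite -[X in decaying _ X](mul0r 0).
  by rewrite FE (decaying_unique fd fd0) mul0r.
pose F' i := C^-1 * F i.
have ext' x : green_ext z F' x = C^-1 * green_ext z F x.
  by rewrite /green_ext mulr_sumr; apply: eq_bigr => i _; rewrite /F'; ring.
have [phis phiy] : is_phi_plus c z (phi_plus c z).
  apply: xgetPex; exists (green_ext z F'); split.
    by apply: green_ext_solution => i; rewrite ext' -FE.
  by apply: filterS far => x fx; rewrite ext' fx mulKf// mulNr.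
have phid : decaying z 1 (phi_plus c z).
  apply: solution_decaying phis _.
  by apply: filterS phiy => x ->; rewrite mul1r mulNr.
exists C; split=> //; last by rewrite FE (decaying_last fd).
by move=> i; rewrite {1}FE; apply: decaying_unique phid _; rewrite mulr1.
Qed.

End ComplexSolutions.

(** * Independence and positivity of the Green kernel *)

Section GreenIndependence.
Variable R : realType.
Implicit Types (x y h s : R).

(** Off its kink, the kernel is a combination of exp(x/2) and exp(-x/2), which
the operator h(y + h) + h(y - h) - 2 cosh(h/2) h(y) annihilates. *)
Lemma green_second_difference y h x :
  0 < h -> (x < y -> x < y - h) -> (y < x -> y + h < x) ->
  green (y + h) x + green (y - h) x -
    (expR (h / 2) + expR (- (h / 2))) * green y x =
  if x == y then expR (- (h / 2)) - expR (h / 2) else 0.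
Proof.
move=> h0 xy yx.
have e A B : expo A B (y + h) + expo A B (y - h) -
    (expR (h / 2) + expR (- (h / 2))) * expo A B y = 0.
  by rewrite /expo 2![(_ + _) / 2]mulrDl !opprD !expRD !mulNr opprK; ring.
case: ltgtP => [/xy ?|/yx ?|->].
- by rewrite !green_right ?e//; lra.
- by rewrite !green_left ?e//; lra.
- rewrite green_refl /green; have -> : y + h - y = h by ring.
  have -> : y - h - y = - h by ring.
  by rewrite normrN gtr0_norm//; ring.
Qed.

(** The second difference at p i, with a step smaller than the distance to the
other points, isolates the term of index i. *)
Lemma green_independent n (p : 'I_n -> R) (A : 'I_n -> R[i]) (B : R[i]) s i :
  (forall y, \sum_j A j * (green y (p j))%:C = B * (green y s)%:C) ->
  (forall j, j != i -> p j != p i) -> s != p i -> A i = 0.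
Proof.
move=> E pi si.
have [h h0 [H1 H2]] : exists2 h : R, 0 < h &
   (forall j, (p j < p i -> p j < p i - h) /\ (p i < p j -> p i + h < p j)) /\
   (s < p i -> s < p i - h) /\ (p i < s -> p i + h < s).
  have [e/= e0 H] := near_separated p (p i).
  have [e'/= e'0 H'] := near_separated (fun _ : 'I_1 => s) (p i).
  have m1 : Num.min e e' <= e by rewrite ge_min lexx.
  have m2 : Num.min e e' <= e' by rewrite ge_min lexx orbT.
  have m0 : 0 < Num.min e e' by rewrite lt_min e0.
  set m := Num.min e e' in m1 m2 m0.
  exists (m / 2); first by lra.
  have b e1 : m <= e1 ->
      `|p i - (p i - m / 2)| < e1 /\ `|p i - (p i + m / 2)| < e1.
    by rewrite !ltr_distlC; lra.
  split=> [j|].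
    have [/H/(_ j)[K _] /H/(_ j)[_ K']] := b _ m1; by split.
  by have [/H'/(_ ord0)[K _] /H'/(_ ord0)[_ K']] := b _ m2; split.
pose k : R := expR (h / 2) + expR (- (h / 2)).
pose dd x := green (p i + h) x + green (p i - h) x - k * green (p i) x.
have ddC x : (dd x)%:C = (green (p i + h) x)%:C + (green (p i - h) x)%:C
    - k%:C * (green (p i) x)%:C.
  by rewrite -rmorphM -rmorphD -rmorphB.
have Edd : \sum_j A j * (dd (p j))%:C = B * (dd s)%:C.
  transitivity (\sum_j A j * (green (p i + h) (p j))%:C +
     \sum_j A j * (green (p i - h) (p j))%:C -
     k%:C * (\sum_j A j * (green (p i) (p j))%:C)).
    rewrite mulr_sumr -big_split -sumrB; apply: eq_bigr => j _ /=.
    by rewrite ddC; ring.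
  by rewrite !E ddC; ring.
move: Edd; rewrite (bigD1 i)//= big1 ?addr0 => [|j ji]; last first.
  rewrite /dd (green_second_difference h0 (H1 j).1 (H1 j).2).
  by rewrite (negPf (pi j ji)) mulr0.
rewrite /dd (green_second_difference h0 (H1 i).1 (H1 i).2).
rewrite (green_second_difference h0 H2.1 H2.2).
rewrite eqxx (negPf si) mulr0 => /eqP; rewrite mulf_eq0 => /orP[/eqP//|].
by rewrite eq_complex /= eqxx andbT subr_eq0 => /eqP/expR_inj ?; exfalso; lra.
Qed.

(** Remove the smallest element a of S: min x y = a + min (x - a) (y - a), and
the last kernel vanishes when x or y is a, so that it only involves the
other elements. *)
Lemma min_gram (S : seq R) : all (fun x => 0 <= x) S ->
  exists (m : nat) (b : R -> 'rV[R]_m), forall x y, x \in S -> y \in S ->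
    b x *m (b y)^T = (Num.min x y)%:M.
Proof.
have [k] := ubnP (size S); elim: k S => // k IH S Sk S0.
have Ss : perm_eq (sort <=%O S) S by rewrite perm_sort.
have : sorted <=%O (sort <=%O S) by apply: sort_sorted; exact: le_total.
case: (sort <=%O S) Ss => [|a s] Ss.
  move=> _; exists 0%N, (fun=> 0) => x y.
  by rewrite -(perm_mem Ss) in_nil.
rewrite /= (path_sortedE le_trans) => /andP[/allP as_ _].
have a0 : 0 <= a.
  by move/allP: S0; apply; rewrite -(perm_mem Ss) mem_head.
have [||m [b bE]] := IH [seq x - a | x <- s].
- by rewrite size_map -ltnS (leq_trans _ Sk)// ltnS -(perm_size Ss).
- by apply/allP => _ /mapP[x xs ->]; rewrite subr_ge0 as_.
exists (1 + m)%N, (fun x => row_mx (Num.sqrt a)%:M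
  (if x == a then 0 else b (x - a))) => x y.
rewrite -!(perm_mem Ss) !in_cons tr_row_mx mul_row_col tr_scalar_mx -scalar_mxM.
rewrite -expr2 sqr_sqrtr//.
have [->|xa] /= := eqVneq x a; have [->|ya] /= := eqVneq y a.
- by rewrite mul0mx addr0 minxx.
- by move=> _ ys; rewrite mul0mx addr0 min_l// as_.
- by move=> xs _; rewrite trmx0 mulmx0 addr0 min_r// as_.
move=> xs ys; rewrite bE; [|exact: (map_f (fun t => t - a) xs)|].
  by apply/matrixP => i j; rewrite !mxE -mulrnDl addr_minr !(addrC a) !subrK.
exact: (map_f (fun t => t - a) ys).
Qed.

End GreenIndependence.

(** * Hermitian eigenbases and Gram realizations of the Green kernel *)

Section HermitianEigenbasis.
Local Open Scope sesquilinear_scope.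
Local Notation "''[' u , v ]" := (dotmx u%R v%R) : ring_scope.
Variable (C : numClosedFieldType).

Lemma dotZl m a (u v : 'rV[C]_m) : '[a *: u, v] = a * '[u, v].
Proof. exact: linearZl_LR. Qed.

Lemma dotDl m (u v w : 'rV[C]_m) : '[u + v, w] = '[u, w] + '[v, w].
Proof. exact: linearDl. Qed.

Lemma dotBl m (u v w : 'rV[C]_m) : '[u - v, w] = '[u, w] - '[v, w].
Proof. exact: linearBl. Qed.

Lemma dot_suml m (I : finType) (u : I -> 'rV[C]_m) (v : 'rV[C]_m) :
  '[\sum_i u i, v] = \sum_i '[u i, v].
Proof. exact: linear_sumlz. Qed.

Lemma dotC m (u v : 'rV[C]_m) : '[u, v] = ('[v, u])^*%R.
Proof. by rewrite [LHS]hermC expr0 mul1r. Qed.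

Lemma dot_eq0 m (u : 'rV[C]_m) : '[u, u] = 0 -> u = 0.
Proof. by move/eqP; rewrite dnorm_eq0 => /eqP. Qed.

Lemma hermitian_eigenbasis m (T : 'M[C]_m) : T^t* = T ->
  exists (e : 'I_m -> 'rV[C]_m) (d : 'I_m -> C),
    [/\ forall a, e a *m T = d a *: e a,
        forall a b, '[e a, e b] = (a == b)%:R &
        forall u, u = \sum_a '[u, e a] *: e a].
Proof.
move=> TT; have /orthomx_spectralP : T \is normalmx.
  by apply/normalmxP; rewrite TT.
set P := spectralmx T; set D := diag_mx _ => TE.
have Pu : P \is unitarymx by exact: spectral_unitarymx.
have PT : P *m T = D *m P by rewrite TE !mulmxA mulmxV ?mul1mx ?unitarymx_unit.
exists (fun a => row a P), (fun a => spectral_diag T 0 a); split.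
- by move=> a; rewrite -row_mul PT row_mul row_diag_mx -scalemxAl -rowE.
- exact/row_unitarymxP.
- move=> u; rewrite -[LHS](mulmxKtV u Pu)// mulmx_sum_row.
  apply: eq_bigr => a _; congr (_ *: _).
  by rewrite dotmxE !mxE; apply: eq_bigr => k _; rewrite !mxE.
Qed.

End HermitianEigenbasis.

Section GreenGram.
Local Open Scope sesquilinear_scope.
Local Notation "''[' u , v ]" := (dotmx u%R v%R) : ring_scope.
Variable R : realType.

Lemma conjC_real (r : R) : (r%:C)^*%R = r%:C.
Proof. by apply: conj_Creal; rewrite complex_real. Qed.

Lemma dot_row_mx m k (u u' : 'rV[R[i]]_m) (v v' : 'rV[R[i]]_k) :
  '[row_mx u v, row_mx u' v'] = '[u, u'] + '[v, v'].
Proof. by rewrite !dotmxE tr_row_mx map_col_mx mul_row_col mxE. Qed.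

Lemma dot_map_real m (u v : 'rV[R]_m) :
  '[map_mx (real_complex R) u, map_mx (real_complex R) v] =
  ((u *m v^T) 0 0)%:C.
Proof.
rewrite dotmxE !mxE rmorph_sum; apply: eq_bigr => k _.
by rewrite !mxE conjC_real rmorphM.
Qed.

(** The vectors e are orthonormal and orthogonal to the b x; they carry the
L^2(v) component of the operator. *)
Lemma green_gram (S : seq R) n :
  exists (m : nat) (b : R -> 'rV[R[i]]_m) (e : 'I_n -> 'rV[R[i]]_m),
    [/\ forall x y, x \in S -> y \in S -> '[b x, b y] = (green x y)%:C,
        forall i j, '[e i, e j] = (i == j)%:R &
        forall x i, '[b x, e i] = 0].
Proof.
have [|m [b bE]] := @min_gram R [seq expR x | x <- S].
  by apply/allP => _ /mapP[x _ ->]; exact: expR_ge0.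
exists (m + n)%N, (fun x => row_mx (map_mx (real_complex R)
  (expR (- (x / 2)) *: b (expR x))) 0), (fun i => row_mx 0 (delta_mx 0 i)).
split=> [x y xS yS|i j|x i]; rewrite dot_row_mx.
- rewrite dot_map_real (_ : (expR (- (y / 2)) *: b (expR y))^T =
    expR (- (y / 2)) *: (b (expR y))^T); last first.
    by apply/matrixP=> i j; rewrite !mxE.
  rewrite -scalemxAl -scalemxAr.
  rewrite bE; [|exact: (map_f expR xS)|exact: (map_f expR yS)].
  rewrite [X in _ + X]dotmxE mul0mx !mxE addr0.
  congr (_%:C); rewrite mulr1n.
  have [xy|yx] := leP x y.
    rewrite min_l ?ler_expR// green_left// /expo mul0r addr0 -!expRD.
    by congr expR; field.
  rewrite min_r ?ler_expR ?ltW// green_right ?ltW// /expo mul0r add0r -!expRD.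
  by congr expR; field.
- rewrite !dotmxE mul0mx mxE add0r !mxE (bigD1 j)//= big1 => [|k kj].
    by rewrite !mxE !eqxx /= rmorph1 mulr1 addr0 eq_sym.
  by rewrite !mxE (negPf kj) andbF rmorph0 mulr0.
- by rewrite !dotmxE mul0mx trmx0 (map_mx0 Num.conj) mulmx0 !mxE addr0.
Qed.

End GreenGram.

(** * The self-adjoint operator of a multipeakon *)

Section Realization.
Local Open Scope sesquilinear_scope.
Local Notation "''[' u , v ]" := (dotmx u%R v%R) : ring_scope.
Variables (R : realType) (c : coefficients R) (S : seq R).
Local Notation n := (npts c).
Local Notation x_ := (@pos R c).
Local Notation C := R[i].
Variables (m : nat) (b : R -> 'rV[C]_m) (s : 'I_n -> 'rV[C]_m).
Hypothesis xS : forall i, x_ i \in S.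
Hypothesis bb : forall x y, x \in S -> y \in S -> '[b x, b y] = (green x y)%:C.
Hypothesis ss : forall i j, '[s i, s j] = (i == j)%:R.
Hypothesis bs : forall x i, '[b x, s i] = 0.
Implicit Types (u e : 'rV[C]_m) (d z : C) (x y : R) (F : 'I_n -> C).

Definition massC (i : 'I_n) : C := (mass i)%:C.
Definition root_dip (i : 'I_n) : C := (Num.sqrt (dip i))%:C.

(** The operator T of the introduction, acting on row vectors from the right.
The vector b x stands for (G(x, .), 0), and s i for the normalized
indicator of x_i in L^2(v); the square root of the mass of v comes from
this normalization. *)
Definition peakon_op : 'M[C]_m := \sum_i
  (massC i *: ((b (x_ i))^t* *m b (x_ i)) +
   root_dip i *: ((b (x_ i))^t* *m s i + (s i)^t* *m b (x_ i))).

Lemma mul_dyad u (v w : 'rV[C]_m) : u *m (v^t* *m w) = '[u, v] *: w.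
Proof. by rewrite mulmxA [u *m _]mx11_scalar -dotmxE mul_scalar_mx. Qed.

Lemma peakon_opE u : u *m peakon_op = \sum_i
  ((massC i * '[u, b (x_ i)] + root_dip i * '[u, s i]) *: b (x_ i) +
   (root_dip i * '[u, b (x_ i)]) *: s i).
Proof.
rewrite mulmx_sumr; apply: eq_bigr => i _.
rewrite mulmxDr -!scalemxAr mulmxDr !mul_dyad.
by rewrite scalerDr !scalerA scalerDl -!addrA; congr (_ + _); exact: addrC.
Qed.

Lemma dyad_adj (v w : 'rV[C]_m) : (v^t* *m w)^t* = w^t* *m v.
Proof. by rewrite trmx_mul map_mxM trmxCK. Qed.

Lemma peakon_op_herm : peakon_op^t* = peakon_op.
Proof.
have sumadj (G : 'I_n -> 'M[C]_m) : (\sum_i G i)^t* = \sum_i (G i)^t*.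
  by rewrite !raddf_sum.
rewrite sumadj; apply: eq_bigr => i _.
have addadj (G G' : 'M[C]_m) : (G + G')^t* = G^t* + G'^t*.
  by rewrite !raddfD.
have scaleadj (r : R) (G : 'M[C]_m) : (r%:C *: G)^t* = r%:C *: G^t*.
  by apply/matrixP => k l; rewrite !mxE rmorphM /= conjC_real.
by rewrite !(addadj, scaleadj) !dyad_adj [X in _ + _ *: X]addrC.
Qed.

Lemma dot_sb i x : '[s i, b x] = 0.
Proof. by rewrite dotC bs conjC0. Qed.

Lemma peakon_op_dot_b u y : y \in S -> '[u *m peakon_op, b y] =
  \sum_i (massC i * '[u, b (x_ i)] + root_dip i * '[u, s i]) *
    (green (x_ i) y)%:C.
Proof.
move=> yS; rewrite peakon_opE dot_suml; apply: eq_bigr => i _.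
by rewrite dotDl !dotZl bb// dot_sb mulr0 addr0.
Qed.

Lemma peakon_op_dot_s u j :
  '[u *m peakon_op, s j] = root_dip j * '[u, b (x_ j)].
Proof.
rewrite peakon_opE dot_suml (bigD1 j)//= big1 ?addr0 => [|i ij].
  by rewrite dotDl !dotZl bs ss eqxx mulr0 add0r mulr1.
by rewrite dotDl !dotZl bs ss (negPf ij) !mulr0 addr0.
Qed.

Lemma root_dip_sqr i : root_dip i * root_dip i = (dip i)%:C.
Proof. by rewrite /root_dip -rmorphM -expr2 sqr_sqrtr// dip_ge0. Qed.

Section Eigenvector.
Variables (e : 'rV[C]_m) (d : C).
Hypothesis eT : e *m peakon_op = d *: e.
Hypothesis d0 : d != 0.
Let F i := '[e, b (x_ i)].

(** The second component of an eigenvector (f, g) of T is g = f/d. *)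
Lemma eigen_dot_s j : '[e, s j] = d^-1 * root_dip j * F j.
Proof.
have := peakon_op_dot_s e j; rewrite eT dotZl => E.
by apply: (mulfI d0); rewrite E !mulrA divff// mul1r.
Qed.

Lemma eigen_green_ext i : F i = green_ext d^-1 F (x_ i).
Proof.
have := peakon_op_dot_b e (xS i); rewrite eT dotZl => E.
apply: (mulfI d0); rewrite E /green_ext mulr_sumr; apply: eq_bigr => j _.
rewrite eigen_dot_s /weight -root_dip_sqr -/(massC j) -/(F j) greenC; field.
exact: d0.
Qed.

Lemma eigen_dot_neq0 : e != 0 -> exists i, F i != 0.
Proof.
move=> e0; apply: contrapT => H.
have F0 i : F i = 0 by apply: contrapT => /eqP Fi; apply: H; exists i.
move/eqP: e0; apply; apply: (scalerI d0); rewrite scaler0 -eT peakon_opE big1//.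
move=> i _; rewrite eigen_dot_s -/(F i) F0 !mulr0 addr0 !scale0r addr0.
by [].
Qed.

Lemma eigen_is_eigenvalue : e != 0 -> is_eigenvalue c d^-1.
Proof.
move=> /eigen_dot_neq0 Fi; apply/eigenvalueP; exists F => // i.
exact: eigen_green_ext.
Qed.

(** The right-hand side is <T e, e>. For an eigenvector whose values at the
points are those of phi_plus, it is the quantity gamma^2. *)
Lemma eigen_norm : d^-1 \is Num.real -> d * '[e, e] =
  \sum_i `|F i| ^+ 2 * massC i + 2 * d^-1 * \sum_i `|F i| ^+ 2 * (dip i)%:C.
Proof.
move=> dr; rewrite -dotZl -eT peakon_opE dot_suml mulr_sumr -big_split.
apply: eq_bigr => i _ /=.
rewrite dotDl !dotZl [ '[b _, e]]dotC [ '[s _, e]]dotC !eigen_dot_s -/(F i).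
rewrite rmorphM rmorphM /= conjC_real (CrealP dr) normCK -root_dip_sqr; ring.
Qed.

End Eigenvector.

Lemma eigen_dot_inj e d : d != 0 -> e *m peakon_op = d *: e ->
  (forall i, '[e, b (x_ i)] = 0) -> e = 0.
Proof.
move=> d0 eT H; apply: contrapT => /eqP e0.
by have [k] := eigen_dot_neq0 eT d0 e0; rewrite H eqxx.
Qed.

Section Basis.
Variables (e : 'I_m -> 'rV[C]_m) (d : 'I_m -> C).
Hypothesis eT : forall a, e a *m peakon_op = d a *: e a.
Hypothesis ee : forall a a', '[e a, e a'] = (a == a')%:R.
Hypothesis eb : forall u, u = \sum_a '[u, e a] *: e a.

Lemma basis_neq0 a : e a != 0.
Proof.
apply: contra_eq_neq (ee a a) => ->; rewrite dotmxE mul0mx mxE eqxx.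
by rewrite eq_sym oner_eq0.
Qed.

Lemma parseval u v : '[u, v] = \sum_a '[u, e a] * '[e a, v].
Proof. by rewrite {1}(eb u) dot_suml; apply: eq_bigr => a _; rewrite dotZl. Qed.

Lemma peakon_op_expand u : u *m peakon_op = \sum_a ('[u, e a] * d a) *: e a.
Proof.
rewrite {1}(eb u) mulmx_suml; apply: eq_bigr => a _.
by rewrite -scalemxAl eT scalerA.
Qed.

Lemma parseval_op u v : '[u *m peakon_op, v] =
  \sum_a d a * ('[u, e a] * '[e a, v]).
Proof.
rewrite peakon_op_expand dot_suml; apply: eq_bigr => a _; rewrite dotZl; ring.
Qed.

Lemma dot_dotC u a : '[u, e a] * '[e a, u] = `|'[e a, u]| ^+ 2.
Proof. by rewrite normCK [ '[u, _]]dotC mulrC. Qed.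

Lemma parseval_green x : x \in S -> \sum_a `|'[e a, b x]| ^+ 2 = 1.
Proof.
move=> xx; have := parseval (b x) (b x); rewrite bb// green_refl => E.
by rewrite -[RHS]/(1%:C : C) E; apply: eq_bigr => a _; rewrite dot_dotC.
Qed.

Lemma peakon_op_dot_green x y : x \in S -> y \in S -> '[b x *m peakon_op, b y] =
  \sum_i massC i * (green x (x_ i))%:C * (green (x_ i) y)%:C.
Proof.
move=> xx yy; rewrite peakon_op_dot_b//; apply: eq_bigr => i _.
by rewrite bs mulr0 addr0 bb.
Qed.

Lemma peakon_op_dot_profile x : x \in S -> '[b x *m peakon_op, b x] =
  (2 * multipeakon_profile c x)%:C.
Proof.
move=> xx; rewrite peakon_op_dot_green//.
rewrite /multipeakon_profile mulrA divff ?pnatr_eq0//.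
rewrite mul1r rmorph_sum; apply: eq_bigr => i _.
rewrite (greenC (x_ i)) -mulrA -!rmorphM -expRD.
by congr (_ * expR _)%:C; field.
Qed.

(** The square of the kernel exp(-|x - y|/2) is the peakon profile exp(-|x -
y|). *)
Lemma parseval_profile x : x \in S -> \sum_a d a * `|'[e a, b x]| ^+ 2 =
  (2 * multipeakon_profile c x)%:C.
Proof.
move=> xx; rewrite -peakon_op_dot_profile// parseval_op.
by apply: eq_bigr => a _; rewrite dot_dotC.
Qed.

(** A solution with values F at the points is the pairing with an explicit
eigenvector of T, for the eigenvalue 1/z, and the expansion of this vector
must involve an element of the basis with the same eigenvalue. *)
Lemma eigenvalue_basis z : is_eigenvalue c z -> z != 0 /\ exists a, d a = z^-1.
Proof.
move=> /eigenvalueP[F [k Fk] FE].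
have z0 : z != 0.
  apply: contraNneq Fk => z0; rewrite FE /green_ext big1// => i _.
  by rewrite /weight z0 expr0n !mul0r addr0 !mul0r.
split=> //.
(* The vector (f, z f), for f the Green sum with values F. *)
pose v : 'rV[C]_m := \sum_i ((weight z i * F i) *: b (x_ i) +
   (z * root_dip i * F i) *: s i).
have vb i : '[v, b (x_ i)] = F i.
  rewrite FE /v dot_suml; apply: eq_bigr => j _.
  by rewrite dotDl !dotZl bb// dot_sb mulr0 addr0 greenC.
have vs j : '[v, s j] = z * root_dip j * F j.
  rewrite /v dot_suml (bigD1 j)//= big1 ?addr0 => [|i ij].
    by rewrite dotDl !dotZl bs ss eqxx mulr0 add0r mulr1.
  by rewrite dotDl !dotZl bs ss (negPf ij) !mulr0 addr0.
have vT : v *m peakon_op = z^-1 *: v.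
  rewrite peakon_opE /v scaler_sumr; apply: eq_bigr => i _.
  rewrite scalerDr !scalerA vb vs; congr (_ *: _ + _ *: _).
    rewrite /weight -root_dip_sqr -/(massC i); field; exact: z0.
  field; exact: z0.
have v0 : v != 0.
  by apply: contraNneq Fk => v0; rewrite -vb v0 dotmxE mul0mx mxE.
apply: contrapT => H; move/eqP: v0; apply.
rewrite (eb v) big1// => a _.
suff -> : '[v, e a] = 0 by rewrite scale0r.
have : (d a - z^-1) * '[v, e a] = 0.
  have := congr1 (fun u => '[u, e a]) vT.
  rewrite /= peakon_op_expand dotZl dot_suml.
  rewrite (bigD1 a)//= big1 ?addr0 => [|a' aa']; last first.
    by rewrite dotZl ee (negPf aa') mulr0.
  by rewrite dotZl ee eqxx mulr1 mulrBl => <-; rewrite [d a * _]mulrC subrr.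
move/eqP; rewrite mulf_eq0 => /orP[|/eqP//]; rewrite subr_eq0 => /eqP da.
by case: H; exists a.
Qed.

Lemma basis_eigenvalue a : d a != 0 -> is_eigenvalue c (d a)^-1.
Proof. by move=> da; apply: eigen_is_eigenvalue (eT a) da (basis_neq0 a). Qed.

End Basis.
End Realization.

(** * Spectral measure of the operator *)

Section Kernel.
Local Open Scope sesquilinear_scope.
Local Notation "''[' u , v ]" := (dotmx u%R v%R) : ring_scope.
Variable R : realType.
Local Notation C := R[i].

(** The norm of sum_i k_i b_i is determined by the Gram matrix, hence the
relation also holds in a realization that contains the kernel of one more
point y. *)
Lemma gram_green_sum n (p : 'I_n -> R) m (b : 'I_n -> 'rV[C]_m)
    (k : 'I_n -> C) :
  (forall i j, '[b i, b j] = (green (p i) (p j))%:C) ->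
  \sum_i k i *: b i = 0 ->
  forall y, \sum_i k i * (green y (p i))%:C = 0.
Proof.
move=> bb sum0 y.
have [m' [b' [_ [bb' _ _]]]] := green_gram (y :: codom p) 0.
have pS i : p i \in y :: codom p by rewrite in_cons codom_f orbT.
pose v := \sum_i k i *: b' (p i).
have vv : '[v, v] = 0.
  have dotE m1 (f : 'I_n -> 'rV[C]_m1) (u := \sum_i k i *: f i) :
      '[u, u] = \sum_i k i * (\sum_j k j * '[f j, f i])^*%R.
    rewrite {1}/u dot_suml; apply: eq_bigr => i _.
    rewrite dotZl dotC; congr (_ * _^*)%R; rewrite dot_suml.
    by apply: eq_bigr => j _; rewrite dotZl.
  have := dotE _ b; rewrite /= sum0 dotmxE mul0mx mxE => ->.
  rewrite /v dotE; apply: eq_bigr => i _; congr (_ * _^*)%R.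
  by apply: eq_bigr => j _; rewrite bb bb'.
have : '[v, b' y] = 0 by rewrite (dot_eq0 vv) dotmxE mul0mx mxE.
rewrite /v dot_suml => vy; rewrite -[RHS]vy; apply: eq_bigr => i _.
by rewrite dotZl bb' ?mem_head// greenC.
Qed.

End Kernel.

Section Spectrum.
Local Open Scope sesquilinear_scope.
Local Notation "''[' u , v ]" := (dotmx u%R v%R) : ring_scope.
Variables (R : realType) (c : coefficients R) (S : seq R).
Local Notation n := (npts c).
Local Notation x_ := (@pos R c).
Local Notation C := R[i].
Variables (m : nat) (b : R -> 'rV[C]_m) (s : 'I_n -> 'rV[C]_m).
Hypothesis xS : forall i, x_ i \in S.
Hypothesis bb : forall x y, x \in S -> y \in S -> '[b x, b y] = (green x y)%:C.
Hypothesis ss : forall i j, '[s i, s j] = (i == j)%:R.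
Hypothesis bs : forall x i, '[b x, s i] = 0.
Local Notation T := (peakon_op b s).

(** The second component of T e = 0 makes <e, b x_i> vanish where v has mass.
The first one is then a relation between kernels of distinct points, hence
trivial, and gives the vanishing where only omega has mass. *)
Lemma kernel_dot (e : 'rV[C]_m) : e *m T = 0 -> forall i, '[e, b (x_ i)] = 0.
Proof.
move=> eT.
have rF i : root_dip i * '[e, b (x_ i)] = 0.
  by rewrite -(peakon_op_dot_s ss bs) eT dotmxE mul0mx mxE.
pose k i : C := massC i * '[e, b (x_ i)] + root_dip i * '[e, s i].
have k0 : \sum_i k i *: b (x_ i) = 0.
  rewrite -[RHS]eT peakon_opE; apply: eq_bigr => i _.
  by rewrite rF scale0r addr0.
have kg := gram_green_sum (fun i j => bb (xS i) (xS j)) k0.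
have ki i : k i = 0.
  apply: (@green_independent R n x_ k 0 (x_ i + 1) i).
  (* x_i + 1 is a dummy point, as the right-hand side is zero. *)
  - by move=> y; rewrite kg mul0r.
  - by move=> j; rewrite (inj_eq (@pos_inj _ _)).
  - by rewrite -subr_eq0 addrAC subrr add0r oner_eq0.
move=> i; have /eqP := rF i; rewrite mulf_eq0 => /orP[/eqP ri|/eqP//].
have di : dip i = 0.
  by apply: (@complexI R); rewrite -root_dip_sqr ri mul0r.
have := ki i; rewrite /k ri mul0r addr0 => /eqP; rewrite mulf_eq0.
move=> /orP[/eqP/(@complexI R) mi|/eqP//].
by have := mass_dip_gt0 i; rewrite mi di normr0 addr0 ltxx.
Qed.

Variables (e : 'I_m -> 'rV[C]_m) (d : 'I_m -> C).
Hypothesis eT : forall a, e a *m T = d a *: e a.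
Hypothesis ee : forall a a', '[e a, e a'] = (a == a')%:R.
Hypothesis eb : forall u, u = \sum_a '[u, e a] *: e a.

Lemma basis_phi_plus a (z := (d a)^-1) : d a != 0 ->
  exists k : C, [/\ k != 0,
    forall i, '[e a, b (x_ i)] = k * phi_plus c z (x_ i) &
    '[e a, b (x_ (last_point c))] = k * (expR (- (x_ (last_point c) / 2)))%:C].
Proof.
move=> da; have Fi := eigen_dot_neq0 ss bs (eT a) da (basis_neq0 ee a).
have FE := eigen_green_ext xS bb ss bs (eT a) da.
exact: eigenvector_phi_plus Fi FE.
Qed.

(** Both eigenvectors have multiples of phi_plus as values at the points, so a
nontrivial combination of them has zero values, and thus is zero. *)
Lemma basis_simple a a' : d a != 0 -> d a = d a' -> a = a'.
Proof.
move=> da daa'; have da' : d a' != 0 by rewrite -daa'.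
have [k [k0 kE _]] := basis_phi_plus da.
have [k' [k'0 k'E _]] := basis_phi_plus da'.
pose v := k' *: e a - k *: e a'.
have v0 : v = 0.
  apply: (eigen_dot_inj ss bs da).
    rewrite mulmxBl -!scalemxAl !eT -daa' /v scalerBr !scalerA.
    by rewrite ![d a * _]mulrC.
  by move=> i; rewrite /v dotBl !dotZl kE k'E -daa'; ring.
apply: contraNeq k'0 => aa'.
have : '[v, e a] = 0 by rewrite v0 dotmxE mul0mx mxE.
by rewrite dotBl !dotZl !ee eqxx eq_sym (negPf aa') mulr1 mulr0 subr0 => ->.
Qed.

(** The eigenvector has values k phi_plus at the points, so that its unit norm
reads 1/l = |k|^2 gamma^2, while phi_plus is exp(-x/2) at the last point. *)
Lemma basis_last_weight a (l : R) : d a = (l%:C)^-1 -> l != 0 ->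
  0 < l * gamma2 c l /\
  `|'[e a, b (x_ (last_point c))]| ^+ 2 =
    (expR (- x_ (last_point c)) / (l * gamma2 c l))%:C.
Proof.
move=> dl l0.
have lC : l%:C != 0 :> C by rewrite eq_complex /= eqxx andbT.
have da : d a != 0 by rewrite dl invr_eq0.
have [k [k0 kE kl]] := basis_phi_plus da.
have dr : (d a)^-1 \is Num.real by rewrite dl invrK complex_real.
have := eigen_norm ss bs (eT a) da dr; rewrite ee eqxx mulr1.
have normcE (w : C) : `|w| = (ComplexField.Normc.normc w)%:C by [].
set g := RHS => dg.
have {dg} dg : d a = `|k| ^+ 2 * (gamma2 c l)%:C.
  rewrite dg /g /gamma2 rmorphD rmorphM !rmorph_sum /= mulrDr mulrCA.
  rewrite !mulr_sumr; congr (_ + _); last first.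
    apply: eq_bigr => i _; rewrite kE normrM exprMn dl invrK !rmorphM normcE.
    by rewrite /= rmorph_nat; ring.
  apply: eq_bigr => i _; rewrite kE normrM exprMn dl invrK !rmorphM normcE.
  by rewrite /massC; ring.
have nk : `|k| ^+ 2 = (ComplexField.Normc.normc k ^+ 2)%:C.
  by rewrite normcE rmorphXn.
have k2 : 0 < ComplexField.Normc.normc k ^+ 2.
  by rewrite -ltcR -nk exprn_gt0 ?normr_gt0.
have E : ComplexField.Normc.normc k ^+ 2 * (l * gamma2 c l) = 1.
  apply: (@complexI R); rewrite rmorphM /= -nk [X in _ * X]rmorphM /=.
  by rewrite mulrCA -dg dl divff.
have g0 : 0 < l * gamma2 c l by rewrite -(pmulr_rgt0 _ k2) E.
split=> //.
have -> : (expR (- x_ (last_point c)) / (l * gamma2 c l)) =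
   ComplexField.Normc.normc k ^+ 2 * expR (- x_ (last_point c)).
  apply: (mulIf (lt0r_neq0 g0)); rewrite divfK ?(lt0r_neq0 g0)//.
  by rewrite mulrAC E mul1r.
rewrite kl normrM exprMn nk -normrX -rmorphXn.
rewrite ger0_norm ?ler0c ?exprn_ge0 ?expR_ge0//.
rewrite -rmorphM; congr (_ * _)%:C.
by rewrite -expRM_natl; congr expR; field.
Qed.

End Spectrum.

Section Consequences.
Local Open Scope sesquilinear_scope.
Local Notation "''[' u , v ]" := (dotmx u%R v%R) : ring_scope.
Variables (R : realType) (c : coefficients R).
Local Notation n := (npts c).
Local Notation x_ := (@pos R c).
Local Notation C := R[i].

Lemma peakon_realization (S0 : seq R) :
  exists (m : nat) (b : R -> 'rV[C]_m) (s : 'I_n -> 'rV[C]_m)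
    (e : 'I_m -> 'rV[C]_m) (d : 'I_m -> C) (S := S0 ++ codom x_),
  [/\ [/\ forall i, x_ i \in S,
        forall x y, x \in S -> y \in S -> '[b x, b y] = (green x y)%:C,
        forall i j, '[s i, s j] = (i == j)%:R &
        forall x i, '[b x, s i] = 0],
      forall a, e a *m (peakon_op b s) = d a *: e a,
      forall a a', '[e a, e a'] = (a == a')%:R &
      forall u, u = \sum_a '[u, e a] *: e a].
Proof.
have [m [b [s [bb ss bs]]]] := green_gram (S0 ++ codom x_) n.
have [e [d [eT ee eb]]] := hermitian_eigenbasis (peakon_op_herm b s).
exists m, b, s, e, d; split=> //; split=> // i.
by rewrite mem_cat codom_f orbT.
Qed.

Lemma normC_real (r : R) : `|r%:C| = `|r|%:C :> C.
Proof. by rewrite normc_def /= expr0n addr0 sqrtr_sqr. Qed.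

Section Bound.
Variable L : R.
Hypothesis Lev : forall z, is_eigenvalue c z ->
  z \is Num.real /\ `|z^-1| <= L%:C.
Hypothesis L0 : 0 <= L.

Lemma multipeakon_bound x : `|2 * multipeakon_profile c x| <= L.
Proof.
have [m [b [s [e [d [[xS bb ss bs] eT ee eb]]]]]] := peakon_realization [:: x].
have xx : x \in [:: x] ++ codom x_ by rewrite mem_head.
rewrite -lecR -normC_real -(parseval_profile xS bb bs eT eb xx).
apply: le_trans (ler_norm_sum _ _ _) _.
rewrite -[leRHS]mulr1 -(parseval_green bb eb xx) mulr_sumr.
apply: ler_sum => a _; rewrite normrM [X in _ * X]ger0_norm ?exprn_ge0//.
rewrite ler_wpM2r ?exprn_ge0//.
have [->|da] := eqVneq (d a) 0; first by rewrite normr0 ler0c.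
have [_] := Lev (basis_eigenvalue xS bb ss bs eT ee da).
by rewrite invrK.
Qed.

(** The sum of the nonnegative terms (L - eps d_a) |<e_a, b x>|^2 is zero,
where eps is the sign of u(x). So b x only involves eigenvectors for the
eigenvalue eps L, and is itself an eigenvector. *)
Lemma multipeakon_extremal x y : `|2 * multipeakon_profile c x| = L ->
  (forall i, dip (c := c) i = 0) /\
  \sum_i massC i * (green x (x_ i))%:C * (green (x_ i) y)%:C =
    (2 * multipeakon_profile c x * green x y)%:C.
Proof.
move=> ux.
have [m [b [s [e [d [[xS bb ss bs] eT ee eb]]]]]] :=
  peakon_realization [:: x; y].
have xx : x \in [:: x; y] ++ codom x_ by rewrite mem_head.
have yy : y \in [:: x; y] ++ codom x_ by rewrite !in_cons eqxx orbT.
pose u := 2 * multipeakon_profile c x.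
pose eps : R := if 0 <= u then 1 else -1.
have uL : u = eps * L.
  rewrite /eps; move: ux; rewrite -/u; case: ltP => ? <-.
    by rewrite ltr0_norm// mulN1r opprK.
  by rewrite ger0_norm// mul1r.
have eps2 : eps * eps = 1.
  by rewrite /eps; case: ifP => _; rewrite ?mulr1// mulrNN mulr1.
have dL a : d a \is Num.real /\ eps%:C * d a <= L%:C.
  have [->|da] := eqVneq (d a) 0; first by rewrite mulr0 ler0c real0.
  have [dr] := Lev (basis_eigenvalue xS bb ss bs eT ee da).
  rewrite invrK => dl; have dr' : d a \is Num.real by rewrite -realV.
  split=> //; apply: le_trans dl; apply: le_trans (real_ler_norm _) _.
    by rewrite realM// complex_real.
  rewrite normrM normC_real /eps; case: ifP => _.
    by rewrite normr1 mul1r.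
  by rewrite normrN normr1 mul1r.
have sum0 : \sum_a (L%:C - eps%:C * d a) * `|'[e a, b x]| ^+ 2 = 0.
  transitivity (L%:C * \sum_a `|'[e a, b x]| ^+ 2 -
      eps%:C * \sum_a d a * `|'[e a, b x]| ^+ 2).
    by rewrite !mulr_sumr -sumrB; apply: eq_bigr => a _; ring.
  rewrite (parseval_green bb eb xx) (parseval_profile xS bb bs eT eb xx) -/u uL.
  by rewrite mulr1 -rmorphM mulrA eps2 mul1r subrr.
have eigen : b x *m peakon_op b s = u%:C *: b x.
  rewrite (peakon_op_expand eT eb) {2}(eb (b x)) scaler_sumr.
  apply: eq_bigr => a _; rewrite scalerA; congr (_ *: _).
  have /eqP : (L%:C - eps%:C * d a) * `|'[e a, b x]| ^+ 2 = 0.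
    apply: (psumr_eq0P _ sum0) => // a' _.
    by rewrite mulr_ge0 ?exprn_ge0// subr_ge0; exact: (dL a').2.
  rewrite mulf_eq0 expf_eq0 /= normr_eq0 => /orP[|/eqP exb].
    rewrite subr_eq0 => /eqP dE; rewrite uL rmorphM /= dE mulrA -rmorphM eps2.
    by rewrite mulrC mul1r.
  by rewrite [ '[b x, _]]dotC exb conjC0 mul0r mulr0.
split=> [i|].
  have := peakon_op_dot_s ss bs (b x) i; rewrite eigen dotZl bs mulr0.
  rewrite bb// => /esym/eqP; rewrite mulf_eq0 => /orP[/eqP ri|].
    by apply: (@complexI R); rewrite -root_dip_sqr ri mul0r.
  by rewrite eq_complex /= eqxx andbT gt_eqF ?green_gt0.
have := peakon_op_dot_green xS bb bs xx yy; rewrite eigen dotZl bb// => <-.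
by rewrite -rmorphM.
Qed.

(** The eigenvector equation for b x is an identity between kernels; the kink
at x_i <> x would give omega_i = 0, while v = 0. *)
Lemma multipeakon_extremal_single x :
  `|2 * multipeakon_profile c x| = L ->
  (forall i, x_ i = x) /\ (forall i, dip (c := c) i = 0).
Proof.
move=> ux; split; last by have [] := multipeakon_extremal x ux.
move=> i; apply: contrapT => /eqP xi.
have di : dip i = 0 by have [] := multipeakon_extremal x ux.
have : massC i * (green x (x_ i))%:C = 0.
  apply: (@green_independent R n x_ (fun i => massC i * (green x (x_ i))%:C)
     (2 * multipeakon_profile c x)%:C x i).
  - move=> y; have [_] := multipeakon_extremal y ux.
    rewrite rmorphM /= (greenC x y) => <-.
    by apply: eq_bigr => j _; rewrite (greenC y).
  - by move=> j; rewrite (inj_eq (@pos_inj _ _)).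
  - by rewrite eq_sym.
move/eqP; rewrite mulf_eq0 => /orP[/eqP/(@complexI R) mi|].
  by have := mass_dip_gt0 i; rewrite mi di normr0 addr0 ltxx.
by rewrite eq_complex /= eqxx andbT gt_eqF ?green_gt0.
Qed.

Lemma multipeakon_extremal_eigenvalue x z z' :
  `|2 * multipeakon_profile c x| = L ->
  is_eigenvalue c z -> is_eigenvalue c z' -> z = z'.
Proof.
move=> /multipeakon_extremal_single[xE dE].
suff H z0 : is_eigenvalue c z0 -> z0^-1 = massC (last_point c).
  by move=> /H E /H E'; apply: invr_inj; rewrite E E'.
move=> /eigenvalueP[F [i Fi] FE].
have iE j : j = last_point c by apply: pos_inj; rewrite !xE.
have : F i = z0 * massC (last_point c) * F i.
  rewrite {1}FE /green_ext (bigD1 i)//= big1 => [|j]; last first.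
    by rewrite (iE i) (iE j) eqxx.
  rewrite addr0 green_refl mulr1 /weight dE mulr0 addr0.
  by rewrite -(iE i).
move=> E; have : (1 - z0 * massC (last_point c)) * F i = 0.
  by rewrite mulrBl mul1r -E subrr.
move/eqP; rewrite mulf_eq0 (negPf Fi) orbF subr_eq0 => /eqP E1.
have z00 : z0 != 0.
  by apply/eqP => z00; move/eqP: E1; rewrite z00 mul0r oner_eq0.
by apply: (mulfI z00); rewrite divff.
Qed.

End Bound.

Section LastPeak.
Variables (N : nat) (lambda : 'I_N -> R).
Hypothesis lambda_inj : injective lambda.
Hypothesis spec : forall z, is_eigenvalue c z <-> exists j, z = (lambda j)%:C.

(** Parseval and the quadratic form of T for the vector b x. The eigenvectors
in the kernel of T do not contribute, and the others correspond
bijectively to the lambda j. *)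
Lemma last_peak (x := x_ (last_point c))
    (p := fun j => expR (- x) / (lambda j * gamma2 c (lambda j))) :
  [/\ forall j, lambda j != 0, forall j, 0 < lambda j * gamma2 c (lambda j),
      \sum_j p j = 1 &
      2 * multipeakon_profile c x = \sum_j (lambda j)^-1 * p j].
Proof.
have [m [b [s [e [d [[xS bb ss bs] eT ee eb]]]]]] := peakon_realization [::].
have evl j : is_eigenvalue c (lambda j)%:C by apply/spec; exists j.
have H j := eigenvalue_basis xS bb ss bs eT ee eb (evl j).
have l0 j : lambda j != 0.
  by have [+ _] := H j; rewrite eq_complex /= eqxx andbT.
have /choice[al alE] : forall j, exists a, d a = ((lambda j)%:C)^-1.
  by move=> j; have [] := H j.
have W j := basis_last_weight xS bb ss bs eT ee (alE j) (l0 j).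
have dal j : d (al j) != 0.
  by rewrite alE invr_eq0 eq_complex /= eqxx andbT.
have keyE (f : 'I_m -> C) : (forall a, d a = 0 -> f a = 0) ->
    \sum_a f a = \sum_j f (al j).
  move=> f0.
  transitivity (\sum_a \sum_j (if d a == d (al j) then f a else 0)).
    apply: eq_bigr => a _; have [da|da] := eqVneq (d a) 0.
      by rewrite f0// big1// => j _; case: ifP.
    have /spec[j dj] := basis_eigenvalue xS bb ss bs eT ee da.
    rewrite (bigD1 j)//= alE -dj invrK eqxx big1 ?addr0// => k kj.
    case: ifP => //; rewrite alE -[d a]invrK dj => /eqP/invr_inj/(@complexI R).
    by move/lambda_inj => E; rewrite E eqxx in kj.
  rewrite exchange_big; apply: eq_bigr => j _; rewrite -big_mkcond.
  rewrite (big_pred1 (al j))// => a /=.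
  apply/eqP/eqP => [E|->//].
  by apply: (basis_simple xS bb ss bs eT ee) => //; rewrite E.
have xx : x \in [::] ++ codom x_ by exact: xS.
have ker a : d a = 0 -> '[e a, b x] = 0.
  by move=> da; apply: (kernel_dot xS bb ss bs); rewrite eT da scale0r.
split=> //; first by move=> j; have [] := W j.
  apply: (@complexI R); rewrite rmorph_sum.
  have := parseval_green bb eb xx; rewrite keyE => [E|a /ker ->].
    by rewrite -[RHS]E; apply: eq_bigr => j _; have [_ ->] := W j.
  by rewrite normr0 expr0n.
apply: (@complexI R); rewrite rmorph_sum.
have := parseval_profile xS bb bs eT eb xx; rewrite keyE => [E|a ->].
  rewrite -[LHS]E; apply: eq_bigr => j _; have [_ ->] := W j.
  by rewrite alE [RHS]rmorphM /= fmorphV.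
by rewrite mul0r.
Qed.

End LastPeak.
End Consequences.

(** * Concentration on the fastest peakon and the theorem *)

Section Concentration.
Variable R : realType.

Lemma expRN_le_inv (y : R) : 0 < y -> expR (- y) <= y^-1.
Proof.
move=> y0; rewrite expRN lef_pV2 ?posrE ?expR_gt0//.
by apply: le_trans (expR_ge1Dx y); rewrite lerDr.
Qed.

(** Since p k <= 1, the weight p j is at most p j / p k, which is a multiple
of exp(- r (|v k| - sg (v k) v j)/2). The exponent is negative for j <> k,
because |v k| is the largest speed in absolute value. The elementary bound
exp(- y) <= 1/y is enough. *)
Lemma dominant_speed (N : nat) (v a : 'I_N -> R) (k : 'I_N) :
  injective v -> (forall j, `|v j| <= `|v k|) -> (forall j, 0 < a j) ->
  exists2 K, 0 <= K & forall r (E : R), 0 < r ->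
    let t := Num.sg (v k) * r in
    let p j := E * (a j * expR (t * v j / 2)) in
    (forall j, 0 <= p j) -> \sum_j p j = 1 ->
    `|v k - \sum_j v j * p j| <= K / r.
Proof.
move=> vinj vk a0.
pose del j := `|v k| - Num.sg (v k) * v j.
have sgv : Num.sg (v k) * v k = `|v k| by rewrite normrEsg.
have sg1 : `|Num.sg (v k)| <= 1.
  by rewrite normr_sg; case: (v k != 0).
have del0 j : j != k -> 0 < del j.
  move=> jk; have vk0 : Num.sg (v k) != 0.
    rewrite sgr_eq0; apply: contraNneq (jk) => vk0; apply/eqP/vinj.
    by have := vk j; rewrite vk0 normr0 normr_le0 => /eqP.
  rewrite /del subr_gt0 lt_neqAle; apply/andP; split.
    apply: contraNneq jk => E; apply/eqP/vinj.
    by apply: (mulfI vk0); rewrite E sgv.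
  apply: le_trans (ler_norm _) _; rewrite normrM.
  by apply: le_trans (vk j); rewrite ler_piMl.
exists (\sum_(j | j != k) `|v k - v j| * (a j / a k * (2 / del j))).
  apply: sumr_ge0 => j /del0 dj.
  by rewrite !mulr_ge0 ?invr_ge0// ?ltW.
move=> r E r0 t p p0 p1.
have E0 : 0 < a k * expR (t * v k / 2) by rewrite mulr_gt0 ?expR_gt0.
have pk1 : p k <= 1.
  by rewrite -p1 (bigD1 k)//= lerDl; apply: sumr_ge0 => j _.
have -> : v k - \sum_j v j * p j = \sum_(j | j != k) (v k - v j) * p j.
  rewrite -[v k in LHS]mulr1 -p1 mulr_sumr -sumrB (bigD1 k)//= subrr add0r.
  by apply: eq_bigr => j _; ring.
apply: le_trans (ler_norm_sum _ _ _) _.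
rewrite mulr_suml; apply: ler_sum => j jk.
rewrite normrM (ger0_norm (p0 j)) -[leRHS]mulrA ler_wpM2l//.
have dj := del0 j jk.
have -> : p j = p k * (a j / a k * expR (- (r * del j / 2))).
  have -> : - (r * del j / 2) = t * v j / 2 - t * v k / 2.
    by rewrite /del -sgv /t; ring.
  rewrite expRD expRN /p; field.
  by rewrite !lt0r_neq0 ?expR_gt0.
rewrite -[leRHS]mul1r ler_pM//.
- by rewrite !mulr_ge0 ?invr_ge0 ?expR_ge0// ?ltW.
rewrite -[leRHS]mulrA; apply: ler_wpM2l; first by apply/ltW/divr_gt0.
apply: le_trans (expRN_le_inv _) _; first by rewrite !mulr_gt0.
rewrite le_eqVlt; apply/orP; left; apply/eqP; field.
by rewrite !lt0r_neq0.
Qed.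

End Concentration.

Theorem theorem5p3 (R : realType) (u : R -> R -> R)
    (mu : R -> {measure set (measurableTypeR R) -> \bar R})
    (coef : R -> coefficients R)
    (u_mu_sol : conservative_multipeakon u mu coef)
    (N : nat) (lambda : 'I_N -> R)
    (lambda_lt : forall i j : 'I_N, (i < j)%N -> lambda i < lambda j)
    (lambda_spec : forall t (z : R[i]),
      is_eigenvalue (coef t) z <-> exists i : 'I_N, z = (lambda i)%:C)
    (lstar : R)
    (lstar_attained : exists i : 'I_N, lstar = `|lambda i|)
    (lstar_min : forall i : 'I_N, lstar <= `|lambda i|) :
  let sup_u := ereal_sup [set (`|u p.1 p.2|)%:E | p in [set: R * R]] in
  sup_u = (1 / (2 * lstar))%:E /\
  ((exists x t : R, (`|u x t|)%:E = sup_u) <-> N = 1%N).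
Proof.
move=> sup_u; have [uE _ _ _ gE] := u_mu_sol.
have lambda_inj : injective lambda.
  move=> i j E; have [/lambda_lt|/lambda_lt|/val_inj//] := ltngtP i j.
    by rewrite E ltxx.
  by rewrite E ltxx.
have P t := last_peak lambda_inj (lambda_spec t).
have l0 j : lambda j != 0 by have [] := P 0.
have [k lk] := lstar_attained.
have ls0 : 0 < lstar by rewrite lk normr_gt0.
pose L := lstar^-1.
have L0 : 0 < L by rewrite invr_gt0.
have Lk : `|(lambda k)^-1| = L by rewrite normrV ?unitfE// -lk.
have Lj j : `|(lambda j)^-1| <= L.
  by rewrite normrV ?unitfE// lef_pV2 ?posrE ?normr_gt0.
have Lev t z : is_eigenvalue (coef t) z -> z \is Num.real /\ `|z^-1| <= L%:C.
  move=> /lambda_spec[j ->]; split; first by rewrite complex_real.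
  by rewrite -fmorphV /= normC_real lecR.
have norm2 (w : R) : `|2 * w| = 2 * `|w| by rewrite normrM gtr0_norm.
have ub x t : 2 * `|u x t| <= L.
  by rewrite uE -norm2; apply: multipeakon_bound (Lev t) (ltW L0) x.
have supE : sup_u = (L / 2)%:E.
  apply/eqP; rewrite eq_le; apply/andP; split.
    apply: ge_ereal_sup => _ [[x t] _ <-]; rewrite lee_fin /=.
    by have := ub x t; lra.
  pose v j := (lambda j)^-1.
  pose a j := (lambda j * gamma2 (coef 0) (lambda j))^-1.
  have vinj : injective v by move=> i j /invr_inj/lambda_inj.
  have a0 j : 0 < a j by rewrite invr_gt0; have [_] := P 0.
  have vk j : `|v j| <= `|v k| by rewrite /v Lk; exact: Lj.
  have [K K0 HK] := dominant_speed vinj vk a0.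
  have low r : 0 < r -> ((L / 2 - K / r / 2)%:E <= sup_u)%E.
    move=> r0; set t := Num.sg (v k) * r.
    pose x := pos (last_point (coef t)).
    apply: le_ereal_sup_tmp; exists (`|u x t|)%:E; first by exists (x, t).
    have [_ g0 p1 pu] := P t.
    have pE j : expR (- x) / (lambda j * gamma2 (coef t) (lambda j)) =
        expR (- x) * (a j * expR (t * v j / 2)).
      rewrite (gE t 0 (lambda j)); last by apply/lambda_spec; exists j.
      have G := g0 j.
      have G0 : gamma2 (coef 0) (lambda j) != 0.
        have [_ /(_ j)/lt0r_neq0] := P 0.
        by rewrite mulf_eq0 negb_or => /andP[].
      rewrite /a /v subr0 [expR (- (t / _))]expRN.
      have -> : t * (lambda j)^-1 / 2 = t / (2 * lambda j) by field; exact: l0.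
      field; rewrite G0 l0 !lt0r_neq0 ?expR_gt0//.
    have := HK r (expR (- x)) r0; rewrite /= -/t => /(_ _ _).
    rewrite lee_fin.
    have E2 : 2 * u x t =
        \sum_j v j * (expR (- x) * (a j * expR (t * v j / 2))).
      by rewrite uE pu; apply: eq_bigr => j _; rewrite pE.
    rewrite -E2 => H.
    have {}H : `|v k - 2 * u x t| <= K / r.
      apply: H; first by move=> j; rewrite !mulr_ge0 ?expR_ge0// ?ltW.
      by rewrite -[RHS]p1; apply: eq_bigr => j _; rewrite pE.
    have := lerB_dist (v k) (2 * u x t); rewrite Lk norm2; lra.
  apply/lee_subgt0Pr => e e0.
  (* This r makes the error K / (2r) equal to e K/(K + 1). *)
  apply: le_trans (low ((K + 1) / (2 * e)) _); last first.
    by rewrite divr_gt0 ?mulr_gt0 ?ltr_wpDl.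
  rewrite -EFinB lee_fin lerD2l lerN2 invf_div.
  rewrite (_ : K * (2 * e / (K + 1)) / 2 = e * (K / (K + 1))); last first.
    by field; rewrite lt0r_neq0 ?ltr_wpDl.
  rewrite ler_piMr ?ltW// ltr_pdivrMr ?ltr_wpDl//; lra.
split; first by rewrite supE; congr (_%:E); rewrite /L; field; exact: lt0r_neq0.
rewrite supE; split=> [[x [t [xt]]]|N1].
  have ext : `|2 * multipeakon_profile (coef t) x| = L.
    by rewrite norm2 -uE xt; field.
  have one i : i = k.
    apply: lambda_inj; apply: (@complexI R).
    by apply: (multipeakon_extremal_eigenvalue (Lev t) (ltW L0) ext);
      apply/lambda_spec; [exists i|exists k].
  have : #|'I_N| = 1%N.
    by apply/eqP/fintype1P; exists k.
  by rewrite card_ord.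
have one i : i = k by subst N; rewrite (ord1 i) (ord1 k).
exists (pos (last_point (coef 0))), 0; congr (_%:E).
have [_ _ p1 pu] := P 0.
have : 2 * u (pos (last_point (coef 0))) 0 = (lambda k)^-1.
  rewrite uE pu -[RHS]mulr1 -p1 mulr_sumr; apply: eq_bigr => j _.
  by rewrite (one j).
by move=> E; have := norm2 (u (pos (last_point (coef 0))) 0); rewrite E Lk; lra.
Qed.
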